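(* Let $X$ and $Y$ be finite posets and let $f:X\to Y$ be order preserving, i.e. $f(x)\le f(x')$ whenever $x\le x'$. Define two partial orders $\le_+^f$ and $\le_-^f$ on the disjoint union $X\sqcup Y$: inside $X$ and inside $Y$ both agree with the original orders, and for $x\in X$, $y\in Y$, $$x\le_+^f y\iff f(x)\le y,\qquad y\le_-^f x\iff y\le f(x),$$ with no other relations. Then the two posets $(X\sqcup Y,\le_+^f)$ and $(X\sqcup Y,\le_-^f)$ are universally derived equivalent.
   Context: For a poset $P$ (viewed as a small category with a unique morphism $p\to p'$ if $p\le p'$ and none otherwise) and a category $\mathcal{A}$, $\mathcal{A}^P$ denotes the category of functors $P\to\mathcal{A}$. If $\mathcal{A}$ is abelian, so is $\mathcal{A}^P$, and $D(\mathcal{A}^P)$ denotes its (unbounded) derived category with its standard triangulated structure. Two posets $P$ and $Q$ are universally derived equivalent if for every abelian category $\mathcal{A}$ the derived categories $D(\mathcal{A}^P)$ and $D(\mathcal{A}^Q)$ are equivalent as triangulated categories. *)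

(* Defs.v *)
From HB Require Import structures.
From mathcomp Require Import all_boot all_order all_algebra.
From mathcomp Require Import boolp.

Set Implicit Arguments.
Unset Strict Implicit.
Unset Printing Implicit Defensive.

Import Order.TTheory GRing.Theory.
Local Open Scope ring_scope.
Local Open Scope quotient_scope.

Record category := Category {
  ob :> Type;
  hom : ob -> ob -> Type;
  idm : forall x, hom x x;
  comp : forall x y z, hom y z -> hom x y -> hom x z;
  comp1m : forall x y (f : hom x y), comp (idm y) f = f;
  compm1 : forall x y (f : hom x y), comp f (idm x) = f;
  compA : forall x y z t (h : hom z t) (g : hom y z) (f : hom x y),
    comp h (comp g f) = comp (comp h g) f
}.
Arguments idm {c} _.
Arguments comp {c x y z} _ _.

Notation "g \c f" := (comp g f)
  (at level 40, left associativity, format "g  \c  f").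

Definition is_iso (C : category) (x y : C) (f : hom x y) : Prop :=
  exists g : hom y x, g \c f = idm x /\ f \c g = idm y.

Lemma iso_square (C : category) (x x' y y' : C) (u : hom x x') (u' : hom x' x)
    (v : hom y y') (v' : hom y' y) (p : hom x y) (q : hom x' y') :
  u' \c u = idm x -> u \c u' = idm x' -> v' \c v = idm y -> v \c v' = idm y' ->
  is_iso q -> v \c p = q \c u -> is_iso p.
Proof.
move=> u'u uu' v'v vv' [g [gq qg]] E; exists (u' \c g \c v); split.
  by rewrite -compA E compA -(compA u') gq compm1 u'u.
have -> : p = v' \c q \c u by rewrite -compA -E compA v'v comp1m.
by rewrite !compA -(compA _ u u') uu' compm1 -(compA v') qg compm1 v'v.
Qed.

Definition monic (C : category) (x y : C) (f : hom x y) : Prop :=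
  forall w (g h : hom w x), f \c g = f \c h -> g = h.

Definition epic (C : category) (x y : C) (f : hom x y) : Prop :=
  forall z (g h : hom y z), g \c f = h \c f -> g = h.

Record functor (C D : category) := Functor {
  fob :> C -> D;
  fmap : forall x y, hom x y -> hom (fob x) (fob y);
  fmap_id : forall x, fmap (idm x) = idm (fob x);
  fmap_comp : forall x y z (g : hom y z) (f : hom x y),
    fmap (g \c f) = fmap g \c fmap f
}.
Arguments fmap {C D} _ {x y} _.

Record nat_trans (C D : category) (F G : functor C D) := NatTrans {
  ncomp :> forall x, hom (F x) (G x);
  naturality : forall x y (f : hom x y),
    ncomp y \c fmap F f = fmap G f \c ncomp x
}.

Lemma nat_transP C D (F G : functor C D) (a b : nat_trans F G) :
  (forall x, a x = b x) -> a = b.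
Proof.
case: a => a na; case: b => b nb /= ab.
have eab : a = b by apply: functional_extensionality_dep.
by subst b; congr NatTrans; apply: Prop_irrelevance.
Qed.

Definition is_nat_iso (C D : category) (F G : functor C D)
    (a : nat_trans F G) : Prop :=
  forall x, is_iso (a x).

Definition functor_id (C : category) : functor C C :=
  @Functor C C (fun x => x) (fun x y f => f) (fun=> erefl)
    (fun x y z g f => erefl).

Section FunctorComp.
Variables (C D E : category) (G : functor D E) (F : functor C D).

Fact functor_comp_id x : fmap G (fmap F (idm x)) = idm (G (F x)).
Proof. by rewrite !fmap_id. Qed.

Fact functor_comp_comp x y z (g : hom y z) (f : hom x y) :
  fmap G (fmap F (g \c f)) = fmap G (fmap F g) \c fmap G (fmap F f).
Proof. by rewrite !fmap_comp. Qed.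

Definition functor_comp : functor C E :=
  @Functor C E (fun x => G (F x)) (fun x y f => fmap G (fmap F f))
    functor_comp_id functor_comp_comp.

End FunctorComp.

Definition is_equivalence (C D : category) (F : functor C D) : Prop :=
  exists (G : functor D C)
         (eta : nat_trans (functor_id C) (functor_comp G F))
         (eps : nat_trans (functor_comp F G) (functor_id D)),
    is_nat_iso eta /\ is_nat_iso eps.

Section PosetCategory.
Variables (d : Order.disp_t) (P : porderType d).

Definition poset_hom (p q : P) : Type := (p <= q)%O.

Definition poset_comp p q r (g : poset_hom q r) (f : poset_hom p q) :
  poset_hom p r := le_trans f g.

Definition poset_cat : category :=
  @Category P poset_hom (@lexx d P) poset_comp
    (fun _ _ _ => bool_irrelevance _ _) (fun _ _ _ => bool_irrelevance _ _)
    (fun _ _ _ _ _ _ _ => bool_irrelevance _ _).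

End PosetCategory.

Section FunctorCategory.
Variables C D : category.

Definition nat_id (F : functor C D) : nat_trans F F.
Proof.
by exists (fun x => idm (F x)) => x y f; rewrite comp1m compm1.
Defined.

Definition nat_comp (F G H : functor C D) (b : nat_trans G H)
  (a : nat_trans F G) : nat_trans F H.
Proof.
exists (fun x => b x \c a x) => x y f.
by rewrite -compA naturality compA naturality compA.
Defined.

Definition functor_cat : category.
Proof.
exists (functor C D) (@nat_trans C D) nat_id nat_comp.
- by move=> F G a; apply: nat_transP => x /=; rewrite comp1m.
- by move=> F G a; apply: nat_transP => x /=; rewrite compm1.
- by move=> F G H K c b a; apply: nat_transP => x /=; rewrite compA.
Defined.

End FunctorCategory.

Record preadditive := Preadditive {
  pre_cat :> category;
  pre_zmod : forall x y : pre_cat, GRing.Zmodule (hom x y);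
  pre_compDl : forall (x y z : pre_cat) (f g : hom y z) (h : hom x y),
    GRing.add (s := GRing.Zmodule.Pack (pre_zmod y z)) f g \c h =
    GRing.add (s := GRing.Zmodule.Pack (pre_zmod x z)) (f \c h) (g \c h);
  pre_compDr : forall (x y z : pre_cat) (h : hom y z) (f g : hom x y),
    h \c GRing.add (s := GRing.Zmodule.Pack (pre_zmod x y)) f g =
    GRing.add (s := GRing.Zmodule.Pack (pre_zmod x z)) (h \c f) (h \c g)
}.

HB.instance Definition _ (A : preadditive) (x y : A) :=
  GRing.Zmodule.copy (hom x y) (GRing.Zmodule.Pack (pre_zmod x y)).

Section PreadditiveTheory.
Variable A : preadditive.
Implicit Types x y z : A.

Lemma compDl x y z (f g : hom y z) (h : hom x y) :
  (f + g) \c h = f \c h + g \c h.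
Proof. exact: pre_compDl. Qed.

Lemma compDr x y z (h : hom y z) (f g : hom x y) :
  h \c (f + g) = h \c f + h \c g.
Proof. exact: pre_compDr. Qed.

Lemma comp0m x y z (h : hom x y) : (0 : hom y z) \c h = 0.
Proof. by apply: (@addrI _ (0 \c h)); rewrite -compDl !addr0. Qed.

Lemma compm0 x y z (h : hom y z) : h \c (0 : hom x y) = 0.
Proof. by apply: (@addrI _ (h \c 0)); rewrite -compDr !addr0. Qed.

Lemma compNm x y z (f : hom y z) (h : hom x y) : (- f) \c h = - (f \c h).
Proof. by apply: (@addrI _ (f \c h)); rewrite -compDl !subrr comp0m. Qed.

Lemma compmN x y z (h : hom y z) (f : hom x y) : h \c (- f) = - (h \c f).
Proof. by apply: (@addrI _ (h \c f)); rewrite -compDr !subrr compm0. Qed.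

End PreadditiveTheory.

Definition is_kernel (A : preadditive) (k x y : A) (i : hom k x)
    (f : hom x y) : Prop :=
  f \c i = 0 /\
  forall w (g : hom w x), f \c g = 0 -> exists! h : hom w k, i \c h = g.

Definition is_cokernel (A : preadditive) (x y c : A) (p : hom y c)
    (f : hom x y) : Prop :=
  p \c f = 0 /\
  forall z (g : hom y z), g \c f = 0 -> exists! h : hom c z, h \c p = g.

(* The zero object, biproducts, kernels and cokernels are chosen, so that
   cohomology and mapping cones are functions. *)
Record abelian := Abelian {
  ab_pre :> preadditive;
  zero_ob : ab_pre;
  zero_obP : idm zero_ob = 0;
  biprod : ab_pre -> ab_pre -> ab_pre;
  inl_m : forall x y, hom x (biprod x y);
  inr_m : forall x y, hom y (biprod x y);
  prl_m : forall x y, hom (biprod x y) x;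
  prr_m : forall x y, hom (biprod x y) y;
  prl_inl : forall x y, prl_m x y \c inl_m x y = idm x;
  prr_inr : forall x y, prr_m x y \c inr_m x y = idm y;
  prl_inr : forall x y, prl_m x y \c inr_m x y = 0;
  prr_inl : forall x y, prr_m x y \c inl_m x y = 0;
  biprod_id : forall x y,
    inl_m x y \c prl_m x y + inr_m x y \c prr_m x y = idm (biprod x y);
  ker : forall x y : ab_pre, hom x y -> ab_pre;
  kerm : forall (x y : ab_pre) (f : hom x y), hom (ker f) x;
  kermP : forall (x y : ab_pre) (f : hom x y), is_kernel (kerm f) f;
  cok : forall x y : ab_pre, hom x y -> ab_pre;
  cokm : forall (x y : ab_pre) (f : hom x y), hom y (cok f);
  cokmP : forall (x y : ab_pre) (f : hom x y), is_cokernel (cokm f) f;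
  monic_kernel : forall (x y : ab_pre) (m : hom x y), monic m ->
    exists (z : ab_pre) (g : hom y z), is_kernel m g;
  epic_cokernel : forall (x y : ab_pre) (e : hom x y), epic e ->
    exists (w : ab_pre) (g : hom w x), is_cokernel e g
}.
Arguments inl_m {a} _ _.
Arguments inr_m {a} _ _.
Arguments prl_m {a} _ _.
Arguments prr_m {a} _ _.

Section AbelianTheory.
Variable A : abelian.
Implicit Types x y z w : A.

Lemma kerm0 x y (f : hom x y) : f \c kerm f = 0.
Proof. by case: (kermP f). Qed.

Lemma cokm0 x y (f : hom x y) : cokm f \c f = 0.
Proof. by case: (cokmP f). Qed.

Lemma kerm_monic x y (f : hom x y) : monic (kerm f).
Proof.
move=> w g h gh; have [_ kerP] := kermP f.
have [|k [_ uk]] := kerP w (kerm f \c g); first by rewrite compA kerm0 comp0m.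
by rewrite -(uk g) // (uk h).
Qed.

Lemma cokm_epic x y (f : hom x y) : epic (cokm f).
Proof.
move=> w g h gh; have [_ cokP] := cokmP f.
have [|k [_ uk]] := cokP w (g \c cokm f); first by rewrite -compA cokm0 compm0.
by rewrite -(uk g) // (uk h).
Qed.

Lemma ker_lift_ex x y w (f : hom x y) (g : hom w x) :
  f \c g = 0 -> exists h : hom w (ker f), kerm f \c h = g.
Proof.
by move=> fg; have [_ /(_ w g fg)[h [hg _]]] := kermP f; exists h.
Qed.

Lemma cok_desc_ex x y z (f : hom x y) (g : hom y z) :
  g \c f = 0 -> exists h : hom (cok f) z, h \c cokm f = g.
Proof.
by move=> gf; have [_ /(_ z g gf)[h [hg _]]] := cokmP f; exists h.
Qed.

Definition ker_lift x y w (f : hom x y) (g : hom w x) (fg : f \c g = 0) :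
  hom w (ker f) := sval (cid (ker_lift_ex fg)).

Definition cok_desc x y z (f : hom x y) (g : hom y z) (gf : g \c f = 0) :
  hom (cok f) z := sval (cid (cok_desc_ex gf)).

Lemma ker_liftK x y w (f : hom x y) (g : hom w x) (fg : f \c g = 0) :
  kerm f \c ker_lift fg = g.
Proof. exact: svalP (cid (ker_lift_ex fg)). Qed.

Lemma cok_descK x y z (f : hom x y) (g : hom y z) (gf : g \c f = 0) :
  cok_desc gf \c cokm f = g.
Proof. exact: svalP (cid (cok_desc_ex gf)). Qed.

Lemma monic_kernel_cok x y (m : hom x y) : monic m -> is_kernel m (cokm m).
Proof.
move=> mm; split=> [|w g cg]; first exact: cokm0.
have [z [u [um uP]]] := monic_kernel mm.
have [|h [hg _]] := uP w g.
  by rewrite -(cok_descK um) -compA cg compm0.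
by exists h; split=> // h' h'g; apply: mm; rewrite hg h'g.
Qed.

Lemma epic_cokernel_ker x y (e : hom x y) : epic e -> is_cokernel e (kerm e).
Proof.
move=> ee; split=> [|w g cg]; first exact: kerm0.
have [z [u [um uP]]] := epic_cokernel ee.
have [|h [hg _]] := uP w g.
  by rewrite -(ker_liftK um) compA cg comp0m.
by exists h; split=> // h' h'g; apply: ee; rewrite hg h'g.
Qed.

End AbelianTheory.

HB.instance Definition _ (C D : category) (F G : functor C D) :=
  gen_eqMixin (nat_trans F G).
HB.instance Definition _ (C D : category) (F G : functor C D) :=
  gen_choiceMixin (nat_trans F G).

Section FunctorPreadditive.
Variables (C : category) (A : preadditive).

Section NatZmodule.
Variables F G : functor C A.
Implicit Types a b : nat_trans F G.

Definition nat_zero : nat_trans F G.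
Proof. by exists (fun x => 0) => x y f; rewrite comp0m compm0. Defined.

Definition nat_add a b : nat_trans F G.
Proof.
by exists (fun x => a x + b x) => x y f; rewrite compDl compDr !naturality.
Defined.

Definition nat_opp a : nat_trans F G.
Proof.
by exists (fun x => - a x) => x y f; rewrite compNm compmN naturality.
Defined.

Fact nat_addA : associative nat_add.
Proof. by move=> a b c; apply: nat_transP => x /=; rewrite addrA. Qed.
Fact nat_addC : commutative nat_add.
Proof. by move=> a b; apply: nat_transP => x /=; rewrite addrC. Qed.
Fact nat_add0 : left_id nat_zero nat_add.
Proof. by move=> a; apply: nat_transP => x /=; rewrite add0r. Qed.
Fact nat_addN : left_inverse nat_zero nat_opp nat_add.
Proof. by move=> a; apply: nat_transP => x /=; rewrite addNr. Qed.

HB.instance Definition _ := GRing.isZmodule.Build (nat_trans F G)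
  nat_addA nat_addC nat_add0 nat_addN.

End NatZmodule.

Definition functor_preadditive : preadditive.
Proof.
exists (functor_cat C A)
  (fun F G => GRing.Zmodule.class (nat_trans F G : zmodType)).
- by move=> F G H f g h; apply: nat_transP => x; apply: compDl.
- by move=> F G H f g h; apply: nat_transP => x; apply: compDr.
Defined.

End FunctorPreadditive.

Section FunctorAbelian.
Variables (C : category) (A : abelian).
Let AC := functor_preadditive C A.
Implicit Types F G H : AC.

Lemma nat_ap F G (a b : hom F G) (x : C) : a = b ->
  (a : nat_trans F G) x = (b : nat_trans F G) x.
Proof. by move->. Qed.

Definition fun_zero : functor C A.
Proof.
exists (fun=> zero_ob A) (fun x y f => idm (zero_ob A)) => //.
by move=> *; rewrite comp1m.
Defined.

Section FunctorBiprod.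
Variables F G : functor C A.

Definition biprod_map (x y x' y' : A) (f : hom x x') (g : hom y y') :
    hom (biprod x y) (biprod x' y') :=
  inl_m x' y' \c f \c prl_m x y + inr_m x' y' \c g \c prr_m x y.

Definition fun_biprod : functor C A.
Proof.
exists (fun x => biprod (F x) (G x))
  (fun x y f => biprod_map (fmap F f) (fmap G f)).
- by move=> x; rewrite /biprod_map !fmap_id !compm1 biprod_id.
- move=> x y z g f; rewrite /biprod_map compDl !compDr !fmap_comp.
  have E (u v w u' v' w' : A) (a : hom v w) (b : hom u v) (c : hom w' u)
      (c' : hom v' w') (d : hom u' v') :
    (a \c b \c c) \c (c' \c d) = a \c b \c (c \c c') \c d by rewrite !compA.
  rewrite ![_ \c (inl_m _ _ \c _ \c _)]compA ![_ \c (inr_m _ _ \c _ \c _)]compA.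
  rewrite !E prl_inl prl_inr prr_inl prr_inr !compm1 !compm0 !comp0m.
  by rewrite addr0 add0r !compA.
Defined.

Definition fun_inl : nat_trans F fun_biprod.
Proof.
exists (fun x => inl_m (F x) (G x)) => x y f /=.
rewrite /biprod_map compDl -!compA prl_inl prr_inl.
by rewrite compm1 !compm0 addr0.
Defined.

Definition fun_inr : nat_trans G fun_biprod.
Proof.
exists (fun x => inr_m (F x) (G x)) => x y f /=.
rewrite /biprod_map compDl -!compA prl_inr prr_inr.
by rewrite compm1 !compm0 add0r.
Defined.

Definition fun_prl : nat_trans fun_biprod F.
Proof.
exists (fun x => prl_m (F x) (G x)) => x y f /=.
rewrite /biprod_map compDr !compA prl_inl prl_inr.
by rewrite comp1m !comp0m addr0.
Defined.

Definition fun_prr : nat_trans fun_biprod G.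
Proof.
exists (fun x => prr_m (F x) (G x)) => x y f /=.
rewrite /biprod_map compDr !compA prr_inl prr_inr.
by rewrite comp1m !comp0m add0r.
Defined.

End FunctorBiprod.

Section FunctorKernel.
Variables (F G : functor C A) (a : nat_trans F G).

Fact fun_ker_subproof x y (f : hom x y) :
  a y \c (fmap F f \c kerm (a x)) = 0.
Proof. by rewrite compA naturality -compA kerm0 compm0. Qed.

Definition fun_ker : functor C A.
Proof.
exists (fun x => ker (a x)) (fun x y f => ker_lift (fun_ker_subproof f)).
- move=> x; apply: (@kerm_monic A).
  by rewrite ker_liftK fmap_id comp1m compm1.
- move=> x y z g f; apply: (@kerm_monic A).
  by rewrite ker_liftK compA ker_liftK -compA ker_liftK compA fmap_comp.
Defined.

Definition fun_kerm : nat_trans fun_ker F.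
Proof.
by exists (fun x => kerm (a x)) => x y f /=; rewrite ker_liftK.
Defined.

Fact fun_cok_subproof x y (f : hom x y) :
  (cokm (a y) \c fmap G f) \c a x = 0.
Proof. by rewrite -compA -naturality compA cokm0 comp0m. Qed.

Definition fun_cok : functor C A.
Proof.
exists (fun x => cok (a x)) (fun x y f => cok_desc (fun_cok_subproof f)).
- move=> x; apply: (@cokm_epic A).
  by rewrite cok_descK fmap_id comp1m compm1.
- move=> x y z g f; apply: (@cokm_epic A).
  by rewrite cok_descK -compA cok_descK compA cok_descK -compA fmap_comp.
Defined.

Definition fun_cokm : nat_trans G fun_cok.
Proof.
by exists (fun x => cokm (a x)) => x y f /=; rewrite cok_descK.
Defined.

End FunctorKernel.

Lemma pointwise_kernel (K F G : AC) (i : hom K F) (a : hom F G) :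
  (forall x : C, is_kernel ((i : nat_trans K F) x) ((a : nat_trans F G) x)) ->
  is_kernel i a.
Proof.
move=> kP; split=> [|H g ag].
  by apply: nat_transP => x; case: (kP x).
have agx x := nat_ap x ag.
have im x : monic ((i : nat_trans K F) x).
  move=> w u v uv; have [ai0 ai] := kP x.
  have [|k [_ uk]] := ai w ((i : nat_trans K F) x \c u).
    by rewrite compA ai0 comp0m.
  by rewrite -(uk u) // (uk v).
pose h x := cid ((kP x).2 _ _ (agx x)).
have hE x : (i : nat_trans K F) x \c sval (h x) = (g : nat_trans H F) x.
  by case: (svalP (h x)).
have hn x y (f : hom x y) :
    sval (h y) \c fmap H f = fmap K f \c sval (h x).
  apply: im; rewrite compA hE (naturality (g : nat_trans H F)).
  by rewrite compA (naturality (i : nat_trans K F)) -compA hE.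
exists (NatTrans hn); split; first exact: nat_transP.
move=> k ik; apply: nat_transP => x; apply: im => /=.
by rewrite hE -ik.
Qed.

Lemma pointwise_cokernel (F G K : AC) (p : hom G K) (a : hom F G) :
  (forall x : C, is_cokernel ((p : nat_trans G K) x) ((a : nat_trans F G) x)) ->
  is_cokernel p a.
Proof.
move=> kP; split=> [|H g ag].
  by apply: nat_transP => x; case: (kP x).
have agx x := nat_ap x ag.
have im x : epic ((p : nat_trans G K) x).
  move=> w u v uv; have [ai0 ai] := kP x.
  have [|k [_ uk]] := ai w (u \c (p : nat_trans G K) x).
    by rewrite -compA ai0 compm0.
  by rewrite -(uk u) // (uk v).
pose h x := cid ((kP x).2 _ _ (agx x)).
have hE x : sval (h x) \c (p : nat_trans G K) x = (g : nat_trans G H) x.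
  by case: (svalP (h x)).
have hn x y (f : hom x y) :
    sval (h y) \c fmap K f = fmap H f \c sval (h x).
  apply: im; rewrite -[RHS]compA hE -(naturality (g : nat_trans G H)).
  by rewrite -compA -(naturality (p : nat_trans G K)) compA hE.
exists (NatTrans hn); split; first exact: nat_transP.
move=> k ik; apply: nat_transP => x; apply: im => /=.
by rewrite hE -ik.
Qed.

Lemma pointwise_monic F G (m : hom F G) (x : C) :
  monic m -> monic ((m : nat_trans F G) x).
Proof.
move=> mm.
have k0 : (fun_kerm m : hom (fun_ker m : AC) F) = 0.
  by apply: mm; rewrite compm0; apply: nat_transP => y; apply: kerm0.
have kx0 : kerm ((m : nat_trans F G) x) = 0 by exact: (nat_ap x k0).
move=> w g h gh; apply/eqP; rewrite -subr_eq0; apply/eqP.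
have mgh : (m : nat_trans F G) x \c (g - h) = 0.
  by rewrite compDr compmN gh subrr.
by rewrite -(ker_liftK mgh) kx0 comp0m.
Qed.

Lemma pointwise_epic F G (e : hom F G) (x : C) :
  epic e -> epic ((e : nat_trans F G) x).
Proof.
move=> ee.
have k0 : (fun_cokm e : hom G (fun_cok e : AC)) = 0.
  by apply: ee; rewrite comp0m; apply: nat_transP => y; apply: cokm0.
have kx0 : cokm ((e : nat_trans F G) x) = 0 by exact: (nat_ap x k0).
move=> w g h gh; apply/eqP; rewrite -subr_eq0; apply/eqP.
have mgh : (g - h) \c (e : nat_trans F G) x = 0.
  by rewrite compDl compNm gh subrr.
by rewrite -(cok_descK mgh) kx0 compm0.
Qed.

Definition functor_abelian : abelian.
Proof.
apply: (@Abelian AC fun_zero _ fun_biprod fun_inl fun_inr fun_prl fun_prr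
  _ _ _ _ _ fun_ker fun_kerm _ fun_cok fun_cokm _ _ _).
- by apply: nat_transP => x; apply: zero_obP.
- by move=> F G; apply: nat_transP => x; apply: prl_inl.
- by move=> F G; apply: nat_transP => x; apply: prr_inr.
- by move=> F G; apply: nat_transP => x; apply: prl_inr.
- by move=> F G; apply: nat_transP => x; apply: prr_inl.
- by move=> F G; apply: nat_transP => x; apply: biprod_id.
- by move=> F G a; apply: pointwise_kernel => x; apply: kermP.
- by move=> F G a; apply: pointwise_cokernel => x; apply: cokmP.
- move=> F G m mm; exists (fun_cok m : AC), (fun_cokm m).
  apply: pointwise_kernel => x.
  by apply: monic_kernel_cok; apply: pointwise_monic.
- move=> F G e ee; exists (fun_ker e : AC), (fun_kerm e).
  apply: pointwise_cokernel => x.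
  by apply: epic_cokernel_ker; apply: pointwise_epic.
Defined.

End FunctorAbelian.

(* A^P, with the pointwise abelian structure. *)
Definition diagrams (d : Order.disp_t) (P : porderType d) (A : abelian) :
  abelian := functor_abelian (poset_cat P) A.

Section Complexes.
Variable A : abelian.

Record complex := Complex {
  cob :> int -> A;
  dif : forall n : int, hom (cob n) (cob (n + 1));
  dif2 : forall n : int, dif (n + 1) \c dif n = 0
}.
Arguments dif : clear implicits.

Record chain_map (X Y : complex) := ChainMap {
  cmap :> forall n : int, hom (X n) (Y n);
  cmap_dif : forall n : int, cmap (n + 1) \c dif X n = dif Y n \c cmap n
}.

Lemma chain_mapP X Y (f g : chain_map X Y) : (forall n, f n = g n) -> f = g.
Proof.
case: f => f nf; case: g => g ng /= fg.
have efg : f = g by apply: functional_extensionality_dep.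
by subst g; congr ChainMap; apply: Prop_irrelevance.
Qed.

Definition chain_id X : chain_map X X.
Proof. by exists (fun n => idm (X n)) => n; rewrite comp1m compm1. Defined.

Definition chain_comp X Y Z (g : chain_map Y Z) (f : chain_map X Y) :
  chain_map X Z.
Proof.
exists (fun n => g n \c f n) => n.
by rewrite /= -compA cmap_dif [LHS]compA cmap_dif compA.
Defined.

Definition complex_cat : category.
Proof.
exists complex chain_map chain_id chain_comp.
- by move=> X Y f; apply: chain_mapP => n /=; rewrite comp1m.
- by move=> X Y f; apply: chain_mapP => n /=; rewrite compm1.
- by move=> X Y Z T h g f; apply: chain_mapP => n /=; rewrite compA.
Defined.

Definition shift_complex (X : complex) : complex.
Proof.
exists (fun n => X (n + 1)) (fun n => - dif X (n + 1)) => n.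
by rewrite compNm compmN dif2 !oppr0.
Defined.

Definition shift_map X Y (f : chain_map X Y) :
  chain_map (shift_complex X) (shift_complex Y).
Proof.
exists (fun n => f (n + 1)) => n /=.
by rewrite compNm compmN cmap_dif.
Defined.

Definition shift_functor : functor complex_cat complex_cat.
Proof.
exists (shift_complex : complex_cat -> complex_cat) shift_map.
- by move=> X; apply: chain_mapP.
- by move=> X Y Z g f; apply: chain_mapP.
Defined.

Section Cone.
Variables (X Y : complex) (f : chain_map X Y).

(* (x, y) |-> (- d x, f x + d y) on X[1] (+) Y, with biproducts written
   as matrices. *)
Definition cone_dif (n : int) :
    hom (biprod (X (n + 1)) (Y n)) (biprod (X (n + 1 + 1)) (Y (n + 1))) :=
  inl_m _ _ \c (- (dif X (n + 1) \c prl_m _ _)) +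
  inr_m _ _ \c (f (n + 1) \c prl_m _ _ + dif Y n \c prr_m _ _).

Lemma prl_cone n : prl_m _ _ \c cone_dif n = - (dif X (n + 1) \c prl_m _ _).
Proof. by rewrite compDr !compA prl_inl prl_inr comp1m comp0m addr0. Qed.

Lemma prr_cone n :
  prr_m _ _ \c cone_dif n = f (n + 1) \c prl_m _ _ + dif Y n \c prr_m _ _.
Proof. by rewrite compDr !compA prr_inl prr_inr comp1m comp0m add0r. Qed.

Definition cone : complex.
Proof.
exists (fun n => biprod (X (n + 1)) (Y n)) cone_dif => n.
have -> : cone_dif (n + 1) \c cone_dif n =
    inl_m _ _ \c (dif X (n + 1 + 1) \c dif X (n + 1) \c prl_m _ _) +
    inr_m _ _ \c ((dif Y (n + 1) \c f (n + 1) - f (n + 1 + 1) \c dif X (n + 1))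
      \c prl_m _ _ + dif Y (n + 1) \c dif Y n \c prr_m _ _).
  rewrite {1}/cone_dif compDl -(compA (inl_m _ _)) -(compA (inr_m _ _)).
  rewrite compNm compDl -!(compA _ _ (cone_dif n)) prl_cone prr_cone.
  rewrite !(compmN, compNm, opprK, compDr, compDl, compA).
  by congr (_ + _); rewrite addrA [- _ + _]addrC.
by rewrite !dif2 cmap_dif subrr !comp0m addr0 !compm0 addr0.
Defined.

Definition cone_inr : chain_map Y cone.
Proof.
exists (fun n => inr_m (X (n + 1)) (Y n)) => n.
rewrite /= /cone_dif compDl -!compA compNm -compA compDl -!compA.
by rewrite prl_inr prr_inr !compm0 oppr0 compm0 !add0r compm1.
Defined.

Definition cone_prl : chain_map cone (shift_complex X).
Proof.
exists (fun n => prl_m (X (n + 1)) (Y n)) => n.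
by rewrite /= prl_cone compNm.
Defined.

End Cone.

End Complexes.

Arguments dif {A} _ _.

Section Cohomology.
Variable A : abelian.

Record short_complex := ShortComplex {
  sc1 : A; sc2 : A; sc3 : A;
  scf : hom sc1 sc2;
  scg : hom sc2 sc3;
  scP : scg \c scf = 0
}.

Record short_map (S T : short_complex) := ShortMap {
  sm1 : hom (sc1 S) (sc1 T);
  sm2 : hom (sc2 S) (sc2 T);
  sm3 : hom (sc3 S) (sc3 T);
  sm12 : sm2 \c scf S = scf T \c sm1;
  sm23 : sm3 \c scg S = scg T \c sm2
}.

(* ker g / im f *)
Definition homology (S : short_complex) : A := cok (ker_lift (scP S)).

Section HomologyMap.
Variables (S T : short_complex) (a : short_map S T).

Fact cycle_map_subproof : scg T \c (sm2 a \c kerm (scg S)) = 0.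
Proof. by rewrite compA -sm23 -compA kerm0 compm0. Qed.

Definition cycle_map : hom (ker (scg S)) (ker (scg T)) :=
  ker_lift cycle_map_subproof.

Fact homology_map_subproof :
  (cokm (ker_lift (scP T)) \c cycle_map) \c ker_lift (scP S) = 0.
Proof.
have -> : (cokm (ker_lift (scP T)) \c cycle_map) \c ker_lift (scP S) =
    cokm (ker_lift (scP T)) \c (ker_lift (scP T) \c sm1 a).
  rewrite -compA; congr (_ \c _); apply: (@kerm_monic A).
  by rewrite !compA !ker_liftK -compA ker_liftK sm12.
by rewrite compA cokm0 comp0m.
Qed.

Definition homology_map : hom (homology S) (homology T) :=
  cok_desc homology_map_subproof.

End HomologyMap.

(* The part X^n -> X^(n+1) -> X^(n+2) of X; its homology is H^(n+1)(X).  Indexing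
   by n rather than n+1 avoids a transport along n - 1 + 1 = n. *)
Definition complex_at (X : complex A) (n : int) : short_complex :=
  ShortComplex (dif2 X n).

Definition chain_map_at (X Y : complex A) (f : chain_map X Y) (n : int) :
    short_map (complex_at X n) (complex_at Y n) :=
  @ShortMap (complex_at X n) (complex_at Y n) (f n) (f (n + 1))
    (f (n + 1 + 1)) (cmap_dif f n) (cmap_dif f (n + 1)).

Definition quasi_iso (X Y : complex_cat A) (f : hom X Y) : Prop :=
  forall n : int, is_iso (homology_map (chain_map_at f n)).

Lemma homology_map_eq S T U V (a : short_map S T) (b : short_map T V)
    (c : short_map S U) (e : short_map U V) :
  sm2 b \c sm2 a = sm2 e \c sm2 c ->
  homology_map b \c homology_map a = homology_map e \c homology_map c.
Proof.
move=> abce; apply: (@cokm_epic A).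
rewrite -!compA !cok_descK !compA !cok_descK -!compA.
congr (_ \c _); apply: (@kerm_monic A).
by rewrite !compA !ker_liftK -!compA !ker_liftK !compA abce.
Qed.

Lemma homology_map_inv S T (a : short_map S T) (b : short_map T S) :
  sm2 b \c sm2 a = idm _ -> homology_map b \c homology_map a = idm _.
Proof.
move=> ba; apply: (@cokm_epic A).
rewrite -!compA !cok_descK !compA !cok_descK comp1m -[RHS]compm1 -!compA.
congr (_ \c _); apply: (@kerm_monic A).
by rewrite !compA !ker_liftK -!compA !ker_liftK !compA ba comp1m compm1.
Qed.

Section ShiftAt.
Variables (X : complex A) (n : int).
Let S := complex_at (shift_complex X) n.
Let T := complex_at X (n + 1).

Definition shift_at : short_map S T.
Proof.
apply: (@ShortMap S T (idm (X (n + 1))) (- idm (X (n + 1 + 1)) : hom _ _)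
  (idm (X (n + 1 + 1 + 1)))) => /=.
- by rewrite compNm compmN opprK comp1m; apply/esym/compm1.
- by rewrite !compmN comp1m; congr (- _); apply/esym/compm1.
Defined.

Definition unshift_at : short_map T S.
Proof.
apply: (@ShortMap T S (idm (X (n + 1))) (- idm (X (n + 1 + 1)) : hom _ _)
  (idm (X (n + 1 + 1 + 1)))) => /=.
- by rewrite !compNm comp1m; congr (- _); apply/esym/compm1.
- by rewrite compNm compmN opprK comp1m; apply/esym/compm1.
Defined.

Lemma shift_atK :
  homology_map unshift_at \c homology_map shift_at = idm _.
Proof. by apply: homology_map_inv; rewrite /= compNm compmN opprK comp1m. Qed.

Lemma unshift_atK :
  homology_map shift_at \c homology_map unshift_at = idm _.
Proof. by apply: homology_map_inv; rewrite /= compNm compmN opprK comp1m. Qed.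

End ShiftAt.

Lemma shift_quasi_iso (X Y : complex_cat A) (f : hom X Y) :
  quasi_iso f -> quasi_iso (fmap (shift_functor A) f).
Proof.
move=> qf n.
have E : homology_map (shift_at Y n) \c
    homology_map (chain_map_at (fmap (shift_functor A) f) n) =
    homology_map (chain_map_at f (n + 1)) \c homology_map (shift_at X n).
  by apply: homology_map_eq; rewrite /= compNm compmN comp1m compm1.
exact: (iso_square (shift_atK X n) (unshift_atK X n) (shift_atK Y n)
  (unshift_atK Y n) (qf (n + 1)) E).
Qed.

End Cohomology.

Section Localization.
Variables (C : category) (W : forall x y : C, hom x y -> Prop).

(* Formal composites of morphisms of C and of formal inverses of morphisms
   of W. *)
Inductive word : C -> C -> Type :=
| word_mor x y : hom x y -> word x y
| word_inv x y (w : hom x y) : W w -> word y x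
| word_comp x y z : word y z -> word x y -> word x z.

(* The least congruence making these formal composites a category in which
   C -> words is a functor and each formal inverse is an inverse. *)
Inductive word_eq : forall x y : C, word x y -> word x y -> Prop :=
| weq_refl x y (p : word x y) : word_eq p p
| weq_sym x y (p q : word x y) : word_eq p q -> word_eq q p
| weq_trans x y (p q r : word x y) : word_eq p q -> word_eq q r -> word_eq p r
| weq_cong x y z (p p' : word y z) (q q' : word x y) :
    word_eq p p' -> word_eq q q' -> word_eq (word_comp p q) (word_comp p' q')
| weq_assoc x y z t (p : word z t) (q : word y z) (r : word x y) :
    word_eq (word_comp p (word_comp q r)) (word_comp (word_comp p q) r)
| weq_idl x y (p : word x y) : word_eq (word_comp (word_mor (idm y)) p) p
| weq_idr x y (p : word x y) : word_eq (word_comp p (word_mor (idm x))) p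
| weq_mor x y z (g : hom y z) (f : hom x y) :
    word_eq (word_mor (g \c f)) (word_comp (word_mor g) (word_mor f))
| weq_invl x y (w : hom x y) (Ww : W w) :
    word_eq (word_comp (word_inv Ww) (word_mor w)) (word_mor (idm x))
| weq_invr x y (w : hom x y) (Ww : W w) :
    word_eq (word_comp (word_mor w) (word_inv Ww)) (word_mor (idm y)).

HB.instance Definition _ x y := gen_eqMixin (word x y).
HB.instance Definition _ x y := gen_choiceMixin (word x y).

Definition word_rel x y : rel (word x y) := fun p q => `[< word_eq p q >].

Fact word_rel_refl x y : reflexive (@word_rel x y).
Proof. by move=> p; apply/asboolP; apply: weq_refl. Qed.
Fact word_rel_sym x y : symmetric (@word_rel x y).
Proof. by move=> p q; apply/asboolP/asboolP; apply: weq_sym. Qed.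
Fact word_rel_trans x y : transitive (@word_rel x y).
Proof.
by move=> q p r /asboolP pq /asboolP qr; apply/asboolP; apply: weq_trans qr.
Qed.

Canonical word_equiv x y := EquivRel (@word_rel x y)
  (@word_rel_refl x y) (@word_rel_sym x y) (@word_rel_trans x y).

Definition loc_hom (x y : C) : Type := {eq_quot (word_equiv x y)}.

Definition loc_class x y (p : word x y) : loc_hom x y :=
  \pi_{eq_quot (word_equiv x y)} p.

Definition loc_repr x y (p : loc_hom x y) : word x y := repr p.

Lemma loc_classP x y (p q : word x y) :
  loc_class p = loc_class q <-> word_eq p q.
Proof.
split=> [pq|pq]; first exact/asboolP/(eqmodP (word_equiv x y) p q).
exact/(eqmodP (word_equiv x y) p q)/asboolP.
Qed.

Lemma loc_reprK x y (p : loc_hom x y) : loc_class (loc_repr p) = p.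
Proof. exact: reprK. Qed.

Lemma loc_repr_class x y (p : word x y) : word_eq (loc_repr (loc_class p)) p.
Proof. by apply/loc_classP; rewrite loc_reprK. Qed.

Definition loc_comp x y z (p : loc_hom y z) (q : loc_hom x y) : loc_hom x z :=
  loc_class (word_comp (loc_repr p) (loc_repr q)).

Lemma loc_comp_class x y z (p : word y z) (q : word x y) :
  loc_comp (loc_class p) (loc_class q) = loc_class (word_comp p q).
Proof. by apply/loc_classP; apply: weq_cong; apply: loc_repr_class. Qed.

Definition localization : category.
Proof.
exists C loc_hom (fun x => loc_class (word_mor (idm x))) loc_comp.
- move=> x y f; rewrite -(loc_reprK f) loc_comp_class.
  by apply/loc_classP; apply: weq_idl.
- move=> x y f; rewrite -(loc_reprK f) loc_comp_class.
  by apply/loc_classP; apply: weq_idr.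
- move=> x y z t h g f; rewrite -(loc_reprK f) -(loc_reprK g) -(loc_reprK h).
  by rewrite !loc_comp_class; apply/loc_classP; apply: weq_assoc.
Defined.

Definition loc_functor : functor C localization.
Proof.
exists (fun x : C => x : localization)
  (fun x y (f : hom x y) => loc_class (word_mor f)) => // x y z g f.
by rewrite [RHS]loc_comp_class; apply/loc_classP; apply: weq_mor.
Defined.

Section LocalizedEndofunctor.
Variables (F : functor C C).
Hypothesis FW : forall x y (w : hom x y), W w -> W (fmap F w).

Fixpoint word_fmap x y (p : word x y) : word (F x) (F y) :=
  match p with
  | word_mor _ _ f => word_mor (fmap F f)
  | word_inv _ _ _ Ww => word_inv (FW Ww)
  | word_comp _ _ _ p q => word_comp (word_fmap p) (word_fmap q)
  end.

Lemma word_fmap_eq x y (p q : word x y) :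
  word_eq p q -> word_eq (word_fmap p) (word_fmap q).
Proof.
elim=> {x y p q} /=.
- by move=> *; apply: weq_refl.
- by move=> x y p q _; apply: weq_sym.
- by move=> x y p q r _ pq _ qr; apply: weq_trans qr.
- by move=> x y z p p' q q' _ pp' _ qq'; apply: weq_cong.
- by move=> *; apply: weq_assoc.
- by move=> x y p; rewrite fmap_id; apply: weq_idl.
- by move=> x y p; rewrite fmap_id; apply: weq_idr.
- by move=> x y z g f; rewrite fmap_comp; apply: weq_mor.
- by move=> x y w Ww; rewrite fmap_id; apply: weq_invl.
- by move=> x y w Ww; rewrite fmap_id; apply: weq_invr.
Qed.

Definition loc_endofunctor : functor localization localization.
Proof.
exists (F : localization -> localization)
  (fun x y (p : loc_hom x y) => loc_class (word_fmap (loc_repr p))).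
- move=> x; apply/loc_classP.
  have := word_fmap_eq (loc_repr_class (word_mor (@idm C x))).
  by rewrite /= fmap_id.
- move=> x y z g f; rewrite [RHS]loc_comp_class; apply/loc_classP.
  exact: (word_fmap_eq (loc_repr_class (word_comp (loc_repr g) (loc_repr f)))).
Defined.

End LocalizedEndofunctor.

End Localization.

(* The data of a triangulated category: an equivalence of triangulated
   categories refers to these only, not to the axioms they satisfy. *)
Record triangulated := Triangulated {
  tri_cat :> category;
  translation : functor tri_cat tri_cat;
  distinguished : forall x y z : tri_cat,
    hom x y -> hom y z -> hom z (translation x) -> Prop
}.

Section DerivedCategory.
Variable A : abelian.

Definition derived_cat : category := localization (@quasi_iso A).

Definition to_derived : functor (complex_cat A) derived_cat :=
  loc_functor (@quasi_iso A).

Definition derived_shift : functor derived_cat derived_cat :=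
  loc_endofunctor (@shift_quasi_iso A).

(* The derived category is obtained by inverting quasi-isomorphisms directly
   in the category of unbounded complexes; passing through the homotopy
   category first gives the same category.  Its distinguished triangles are
   the triangles isomorphic in it to the image of some X -> Y -> cone f -> X[1]. *)
Definition derived_distinguished (x y z : derived_cat) (u : hom x y)
    (v : hom y z) (w : hom z (derived_shift x)) : Prop :=
  exists (X Y : complex_cat A) (f : hom X Y)
         (a : hom x (to_derived X)) (b : hom y (to_derived Y))
         (c : hom z (to_derived (cone f))),
    [/\ is_iso a, is_iso b & is_iso c] /\
    [/\ b \c u = fmap to_derived f \c a,
        c \c v = fmap to_derived (cone_inr f : hom Y (cone f : complex_cat A))
                 \c b &
        fmap derived_shift a \c w =
        fmap to_derived (cone_prl f : hom (cone f : complex_cat A)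
                                          (shift_functor A X)) \c c].

Definition derived : triangulated :=
  @Triangulated derived_cat derived_shift derived_distinguished.

End DerivedCategory.

(* Additivity of F need not be required: an equivalence preserves finite
   biproducts, which determine the addition of morphisms. *)
Definition triangle_equivalent (S T : triangulated) : Prop :=
  exists (F : functor S T)
         (phi : nat_trans (functor_comp F (translation S))
                          (functor_comp (translation T) F)),
    [/\ is_equivalence F, is_nat_iso phi &
        forall (x y z : S) (u : hom x y) (v : hom y z)
               (w : hom z (translation S x)),
          distinguished u v w ->
          distinguished (fmap F u) (fmap F v) (phi x \c fmap F w)].

Definition universally_derived_equivalent (d d' : Order.disp_t)
    (P : porderType d) (Q : porderType d') : Prop :=
  forall A : abelian,
    triangle_equivalent (derived (diagrams P A)) (derived (diagrams Q A)).

Section Glue.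
Variables (d d' : Order.disp_t) (X : finPOrderType d) (Y : finPOrderType d').
Variables (f : X -> Y) (f_homo : {homo f : x x' / (x <= x')%O}).

Definition le_plus (a b : X + Y) : bool :=
  match a, b with
  | inl x, inl x' => (x <= x')%O
  | inr y, inr y' => (y <= y')%O
  | inl x, inr y => (f x <= y)%O
  | inr _, inl _ => false
  end.

Definition le_minus (a b : X + Y) : bool :=
  match a, b with
  | inl x, inl x' => (x <= x')%O
  | inr y, inr y' => (y <= y')%O
  | inr y, inl x => (y <= f x)%O
  | inl _, inr _ => false
  end.

Fact le_plus_refl : reflexive le_plus.
Proof. by case=> x /=. Qed.
Fact le_plus_anti : antisymmetric le_plus.
Proof. by case=> [x|y] [x'|y'] //=; [move/le_anti-> | rewrite andbF | move/le_anti->]. Qed.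
Fact le_plus_trans : transitive le_plus.
Proof.
case=> [x2|y2] [x1|y1] [x3|y3] //=; try exact: le_trans.
by move=> /f_homo; apply: le_trans.
Qed.

Fact le_minus_refl : reflexive le_minus.
Proof. by case=> x /=. Qed.
Fact le_minus_anti : antisymmetric le_minus.
Proof. by case=> [x|y] [x'|y'] //=; [move/le_anti-> | rewrite andbF | move/le_anti->]. Qed.
Fact le_minus_trans : transitive le_minus.
Proof.
case=> [x2|y2] [x1|y1] [x3|y3] //=; try exact: le_trans.
by move=> y1x2 /f_homo; apply: le_trans.
Qed.

(* Copies of X + Y carrying the two orders; f_homo makes them transitive. *)
Definition glue_plus of {homo f : x x' / (x <= x')%O} : Type := (X + Y)%type.
Definition glue_minus of {homo f : x x' / (x <= x')%O} : Type := (X + Y)%type.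

HB.instance Definition _ := Finite.copy (glue_plus f_homo) (X + Y)%type.
HB.instance Definition _ := Finite.copy (glue_minus f_homo) (X + Y)%type.

HB.instance Definition _ := Order.Le_isPOrder.Build (Order.Disp tt tt)
  (glue_plus f_homo) le_plus_refl le_plus_anti le_plus_trans.
HB.instance Definition _ := Order.Le_isPOrder.Build (Order.Disp tt tt)
  (glue_minus f_homo) le_minus_refl le_minus_anti le_minus_trans.

End Glue.

(* Main.v *)
(** A diagram on [(X + Y, <=_+)] is a map [phi : F -> f^* G] with F over X and G
over Y; a diagram on [(X + Y, <=_-)] is a map [psi : f^* G -> F]. For
complexes, [phi] is sent to the inclusion [f^* G -> cone phi], and [psi] to
the projection [cone psi -> (f^* G)[1]]. Both assignments are exact functors
of complexes since cones are formed pointwise, so they descend to derived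
categories without resolutions. The cone of [Y -> cone f] is homotopy
equivalent to [X[1]], and so is that of [cone g -> Y[1]] for [g : Y -> X];
hence both composites are isomorphic to the shift, which is invertible. *)

(* Both functors rotate triangles: [to_minus] replaces F -> f^* G by the next map of its cone
   triangle, and [to_plus] moves two places further. Three rotations amount, up to signs, to one
   shift, which is why the composites are the shift and not the identity. Cones are not functorial
   in a derived category, but they are functorial for strictly commuting squares of complexes. The
   work is therefore done on functors from the posets to complexes, where all squares commute
   strictly and the comparison maps must be strict as well; complexes of diagrams are converted to
   such functors and back. Compatibility with triangles is a separate matter: the functor is itself
   a cone, so it has to be exchanged with the shift and with the cone of a chain map, and each
   exchange introduces a sign on the summand that is shifted twice. *)
From mathcomp Require Import all_boot all_order all_algebra.
From mathcomp Require Import boolp.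
Require Import Defs.

Set Implicit Arguments.
Unset Strict Implicit.
Unset Printing Implicit Defensive.

Import Order.TTheory GRing.Theory.
Local Open Scope ring_scope.

(** * Categories and localization *)

Section Categories.
Implicit Types C D : category.

Lemma is_iso_id C (x : C) : is_iso (idm x).
Proof. by exists (idm x); rewrite !comp1m. Qed.

Lemma is_iso_comp C (x y z : C) (g : hom y z) (f : hom x y) :
  is_iso g -> is_iso f -> is_iso (g \c f).
Proof.
move=> [g' [g'g gg']] [f' [f'f ff']]; exists (f' \c g'); split.
  by rewrite -compA (compA g') g'g comp1m.
by rewrite -compA (compA f) ff' comp1m.
Qed.

Lemma is_iso_fmap C D (F : functor C D) (x y : C) (f : hom x y) :
  is_iso f -> is_iso (fmap F f).
Proof.
move=> [g [gf fg]]; exists (fmap F g).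
by rewrite -!fmap_comp gf fg !fmap_id.
Qed.

End Categories.

Section Inverses.
Variable C : category.

(** Choice extracts the inverse from the existential [is_iso], so that inverses taken object by
    object or degree by degree can be assembled into one transformation or chain map. *)
Definition inv_of (x y : C) (f : hom x y) (fi : is_iso f) : hom y x :=
  sval (cid fi).

Lemma inv_ofK (x y : C) (f : hom x y) (fi : is_iso f) :
  inv_of fi \c f = idm x.
Proof. by rewrite /inv_of; case: cid => g []. Qed.

Lemma inv_ofKV (x y : C) (f : hom x y) (fi : is_iso f) :
  f \c inv_of fi = idm y.
Proof. by rewrite /inv_of; case: cid => g []. Qed.

Lemma is_iso_inv_of (x y : C) (f : hom x y) (fi : is_iso f) :
  is_iso (inv_of fi).
Proof. by exists f; rewrite inv_ofK inv_ofKV. Qed.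

Lemma inv_of_square (x x' y y' : C) (f : hom x y) (g : hom x' y')
    (fi : is_iso f) (gi : is_iso g) (u : hom x x') (v : hom y y') :
  g \c u = v \c f -> inv_of gi \c v = u \c inv_of fi.
Proof.
move=> E; rewrite -[LHS]compm1 -(inv_ofKV fi) compA -(compA _ v) -E.
by rewrite (compA _ g) inv_ofK comp1m.
Qed.

End Inverses.

Lemma nat_isoP (C D : category) (F G : functor_cat C D) (a : hom F G) :
  (forall x : C, is_iso ((a : nat_trans F G) x)) <-> is_iso a.
Proof.
split=> [ai|[b [ba ab]] x]; last first.
  exists ((b : nat_trans G F) x); split.
    by have := congr1 (fun n : nat_trans F F => n x) ba.
  by have := congr1 (fun n : nat_trans G G => n x) ab.
have bn x y (f : hom x y) :
    inv_of (ai y) \c fmap G f = fmap F f \c inv_of (ai x).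
  by apply: inv_of_square; rewrite naturality.
exists (NatTrans bn); split; apply: nat_transP => x /=.
  exact: inv_ofK.
exact: inv_ofKV.
Qed.

(* A left and a right quasi-inverse of F are isomorphic, through
   G' ~ G' F G ~ G; hence either of them is a two-sided one. *)
Lemma two_sided_equivalence (C D : category) (F : functor C D)
    (G G' : functor D C)
    (eps : nat_trans (functor_comp F G) (functor_id D))
    (eta : nat_trans (functor_id C) (functor_comp G' F)) :
  is_nat_iso eps -> is_nat_iso eta -> is_equivalence F.
Proof.
move=> epsi etai.
have Gei x : is_iso (fmap G' (eps (F x))) by apply: is_iso_fmap.
pose a x : hom x (G (F x)) :=
  inv_of (etai (G (F x))) \c (inv_of (Gei x) \c eta x).
have an x y (f : hom x y) :
    a y \c fmap (functor_id C) f = fmap (functor_comp G F) f \c a x.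
  have E1 : eta y \c f = fmap G' (fmap F f) \c eta x := naturality eta f.
  have E2 : inv_of (Gei y) \c fmap G' (fmap F f) =
      fmap G' (fmap F (fmap G (fmap F f))) \c inv_of (Gei x).
    apply: inv_of_square; rewrite -!fmap_comp.
    by congr (fmap G' _); apply: (naturality eps).
  have E3 : inv_of (etai (G (F y))) \c fmap G' (fmap F (fmap G (fmap F f))) =
      fmap G (fmap F f) \c inv_of (etai (G (F x))).
    by apply: inv_of_square; apply: (naturality eta).
  rewrite /a /= -!compA E1 (compA _ (fmap G' _)) E2 -compA (compA _ (fmap G' _)).
  by rewrite E3 -!compA.
exists G, (@NatTrans _ _ (functor_id C) (functor_comp G F) a an), eps; split=> // x.
apply: is_iso_comp; first exact: is_iso_inv_of.
apply: is_iso_comp; first exact: is_iso_inv_of.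
exact: etai.
Qed.

Section Localizations.
Variables (C D : category).
Variables (W : forall x y : C, hom x y -> Prop).

Lemma loc_functor_iso (x y : C) (f : hom x y) :
  W f -> is_iso (fmap (loc_functor W) f).
Proof.
move=> Wf; exists (loc_class (word_inv Wf)).
split; rewrite [LHS]loc_comp_class; apply/loc_classP.
  exact: weq_invl.
exact: weq_invr.
Qed.

(** A morphism of the localization is a composite of images of morphisms of [C] and of formal
    inverses, and a square that commutes for an invertible morphism commutes for its inverse.
    Transformations between derived functors can thus be checked on chain maps alone. *)
Lemma loc_naturality (S T : functor (localization W) D)
    (a : forall x : C, hom (S x) (T x)) :
  (forall (x y : C) (f : hom x y),
    a y \c fmap S (fmap (loc_functor W) f) =
    fmap T (fmap (loc_functor W) f) \c a x) ->
  forall (x y : localization W) (p : hom x y),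
    a y \c fmap S p = fmap T p \c a x.
Proof.
move=> an x y p; rewrite -(loc_reprK p).
elim: (loc_repr p) => {x y p} [x y f|x y w Ww|x y z p IHp q IHq].
- exact: an.
- pose v : @hom (localization W) y x := loc_class (word_inv Ww).
  have vw : v \c fmap (loc_functor W) w = idm _.
    by rewrite [LHS]loc_comp_class; apply/loc_classP/weq_invl.
  have wv : fmap (loc_functor W) w \c v = idm _.
    by rewrite [LHS]loc_comp_class; apply/loc_classP/weq_invr.
  rewrite -/v -[LHS]comp1m -(fmap_id T) -vw fmap_comp -compA (compA _ (a x)).
  by rewrite -an -compA -fmap_comp wv fmap_id compm1.
- have E : loc_class (word_comp p q) =
      (loc_class p : @hom (localization W) y z) \c loc_class q.
    by rewrite [RHS]loc_comp_class.
  by rewrite E !fmap_comp compA IHp -compA IHq compA.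
Qed.

End Localizations.

Section LocalizedFunctor.
Variables (C D : category) (V : forall x y : C, hom x y -> Prop).
Variables (W : forall x y : D, hom x y -> Prop) (F : functor C D).
Hypothesis FW : forall (x y : C) (w : hom x y), V w -> W (fmap F w).

(** The counterpart of [word_fmap], which treats endofunctors, for a functor between two different
    categories. *)
Fixpoint word_map x y (p : word V x y) : word W (F x) (F y) :=
  match p with
  | word_mor _ _ f => word_mor W (fmap F f)
  | word_inv _ _ _ Ww => word_inv (FW Ww)
  | word_comp _ _ _ p q => word_comp (word_map p) (word_map q)
  end.

Lemma word_map_eq x y (p q : word V x y) :
  word_eq p q -> word_eq (word_map p) (word_map q).
Proof.
elim=> {x y p q} /=.
- by move=> *; apply: weq_refl.
- by move=> x y p q _; apply: weq_sym.
- by move=> x y p q r _ pq _ qr; apply: weq_trans qr.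
- by move=> x y z p p' q q' _ pp' _ qq'; apply: weq_cong.
- by move=> *; apply: weq_assoc.
- by move=> x y p; rewrite fmap_id; apply: weq_idl.
- by move=> x y p; rewrite fmap_id; apply: weq_idr.
- by move=> x y z g f; rewrite fmap_comp; apply: weq_mor.
- by move=> x y w Ww; rewrite fmap_id; apply: weq_invl.
- by move=> x y w Ww; rewrite fmap_id; apply: weq_invr.
Qed.

Definition localized : functor (localization V) (localization W).
Proof.
exists (F : localization V -> localization W)
  (fun x y (p : loc_hom V x y) => loc_class (word_map (loc_repr p))).
- move=> x; apply/loc_classP.
  have := word_map_eq (loc_repr_class (word_mor V (@idm C x))).
  by rewrite /= fmap_id.
- move=> x y z g f; rewrite [RHS]loc_comp_class; apply/loc_classP.
  exact: (word_map_eq (loc_repr_class (word_comp (loc_repr g) (loc_repr f)))).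
Defined.

(** Not a computation: [localized] acts on the representative chosen by [loc_repr], which is only
    congruent to the one-letter word. *)
Lemma localized_mor (x y : C) (f : hom x y) :
  fmap localized (fmap (loc_functor V) f) = fmap (loc_functor W) (fmap F f).
Proof.
by apply/loc_classP; apply: (word_map_eq (loc_repr_class (word_mor V f))).
Qed.

End LocalizedFunctor.

Lemma loc_endofunctor_mor (C : category) (W : forall x y : C, hom x y -> Prop)
    (F : functor C C) (FW : forall (x y : C) (w : hom x y), W x y w -> W _ _ (fmap F w))
    (x y : C) (f : hom x y) :
  fmap (loc_endofunctor FW) (fmap (loc_functor W) f) =
  fmap (loc_functor W) (fmap F f).
Proof.
by apply/loc_classP; apply: (word_fmap_eq FW (loc_repr_class (word_mor W f))).
Qed.

(** * Generalized elements in an abelian category *)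

Section Pairing.
Variable A : abelian.
Implicit Types x y z w : A.

(* Locked, so that rewriting does not see the sum. *)
Definition pair_m w x y (u : hom w x) (v : hom w y) : hom w (biprod x y) :=
  locked (inl_m x y \c u + inr_m x y \c v).

Lemma prl_pair w x y (u : hom w x) (v : hom w y) :
  prl_m x y \c pair_m u v = u.
Proof.
by rewrite /pair_m -lock compDr !compA prl_inl prl_inr comp1m comp0m addr0.
Qed.

Lemma prr_pair w x y (u : hom w x) (v : hom w y) :
  prr_m x y \c pair_m u v = v.
Proof.
by rewrite /pair_m -lock compDr !compA prr_inl prr_inr comp1m comp0m add0r.
Qed.

Lemma prl_pairA w' w x y (u : hom w x) (v : hom w y) (t : hom w' w) :
  prl_m x y \c (pair_m u v \c t) = u \c t.
Proof. by rewrite compA prl_pair. Qed.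

Lemma prr_pairA w' w x y (u : hom w x) (v : hom w y) (t : hom w' w) :
  prr_m x y \c (pair_m u v \c t) = v \c t.
Proof. by rewrite compA prr_pair. Qed.

Lemma pair_ext w x y (u v : hom w (biprod x y)) :
  prl_m x y \c u = prl_m x y \c v -> prr_m x y \c u = prr_m x y \c v -> u = v.
Proof.
move=> l r; rewrite -[u]comp1m -[v]comp1m -biprod_id !compDl -!compA.
by rewrite l r.
Qed.

Lemma prl_inlA w x y (t : hom w x) : prl_m x y \c (inl_m x y \c t) = t.
Proof. by rewrite compA prl_inl comp1m. Qed.

Lemma prl_inrA (x y w : A) (t : hom w y) : prl_m x y \c (inr_m x y \c t) = 0.
Proof. by rewrite compA prl_inr comp0m. Qed.

Lemma prr_inlA (x y w : A) (t : hom w x) : prr_m x y \c (inl_m x y \c t) = 0.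
Proof. by rewrite compA prr_inl comp0m. Qed.

Lemma prr_inrA (x y w : A) (t : hom w y) : prr_m x y \c (inr_m x y \c t) = t.
Proof. by rewrite compA prr_inr comp1m. Qed.

End Pairing.

Section GeneralizedElements.
Variable A : abelian.
Implicit Types x y z w : A.

Lemma monicP x y (m : hom x y) :
  (forall w (t : hom w x), m \c t = 0 -> t = 0) -> monic m.
Proof.
move=> m0 w g h gh; apply/eqP; rewrite -subr_eq0; apply/eqP/m0.
by rewrite compDr compmN gh subrr.
Qed.

Lemma epicP x y (e : hom x y) :
  (forall z (t : hom y z), t \c e = 0 -> t = 0) -> epic e.
Proof.
move=> e0 w g h gh; apply/eqP; rewrite -subr_eq0; apply/eqP/e0.
by rewrite compDl compNm gh subrr.
Qed.

Lemma epic_comp x y z (g : hom y z) (f : hom x y) :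
  epic g -> epic f -> epic (g \c f).
Proof. by move=> eg ef w u v; rewrite !compA => /ef/eg. Qed.

Lemma epic_id x : epic (idm x).
Proof. by move=> z g h; rewrite !compm1. Qed.

Lemma epicr x y z (g : hom y z) (f : hom x y) : epic (g \c f) -> epic g.
Proof. by move=> e w u v uv; apply: e; rewrite !compA uv. Qed.

(** A monomorphism is the kernel of its cokernel; if it is also epic, that cokernel is zero, and the
    identity lifts through the kernel. *)
Lemma is_iso_monic_epic x y (f : hom x y) : is_iso f <-> monic f /\ epic f.
Proof.
split=> [[g [gf fg]]|[mf ef]].
  split=> [w u v uv|z u v uv].
    by rewrite -[u]comp1m -[v]comp1m -gf -!compA uv.
  by rewrite -[u]compm1 -[v]compm1 -fg !compA uv.
have [_ kf] := monic_kernel_cok mf.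
have c0 : cokm f = 0 by apply: ef; rewrite cokm0 comp0m.
have [|g [fg _]] := kf y (idm y); first by rewrite c0 comp0m.
by exists g; split=> //; apply: mf; rewrite compA fg comp1m compm1.
Qed.

(** The pullback is the kernel of [d = (e, - g)]. As [d] is epic, it is the cokernel of this kernel,
    so a map that vanishes after [e'] factors, on the biproduct, as [m d]; restricting to [x] gives
    [m e = 0], hence [m = 0]. *)
Lemma epic_pullback x z w (e : hom x z) (g : hom w z) : epic e ->
  exists (p : A) (e' : hom p w) (g' : hom p x), epic e' /\ e \c g' = g \c e'.
Proof.
move=> ee; pose d := e \c prl_m x w - g \c prr_m x w.
have dl : d \c inl_m x w = e.
  by rewrite compDl compNm -!compA prl_inl prr_inl compm1 compm0 subr0.
have dr : d \c inr_m x w = - g.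
  by rewrite compDl compNm -!compA prl_inr prr_inr compm1 compm0 add0r.
have ed : epic d by apply: (@epicr _ _ _ _ (inl_m x w)); rewrite dl.
exists (ker d), (prr_m x w \c kerm d), (prl_m x w \c kerm d); split.
  apply: epicP => t h; rewrite compA => /(proj2 (epic_cokernel_ker ed)).
  move=> [m [md _]].
  have m0 : m = 0.
    apply: ee; rewrite comp0m -[in LHS]dl compA md -compA prr_inl.
    by rewrite compm0.
  by rewrite -[h]compm1 -(prr_inr x w) compA -md m0 !comp0m.
by apply/eqP; rewrite !compA -subr_eq0 -compNm -compDl kerm0.
Qed.

(** Exactness for generalized elements: what dies in the cokernel comes from [x] after restriction
    along an epimorphism. This is the basic tool of the diagram chases below. *)
Lemma cok_zero x y w (u : hom x y) (t : hom w y) : cokm u \c t = 0 ->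
  exists (p : A) (e : hom p w) (s : hom p x), epic e /\ t \c e = u \c s.
Proof.
move=> ut.
pose i := kerm (cokm u); pose q := ker_lift (cokm0 u).
have iq : i \c q = u by apply: ker_liftK.
(* If [h q = 0], then [u] factors through the subobject [i k], where [k] is the kernel of [h]. The
   cokernel of [i k] kills [u], hence also [i], so [i] factors through [i k]; then [k] is split epic
   and [h = 0]. *)
have eq : epic q.
  apply: epicP => z h hq; pose k := kerm h.
  have mk : monic (i \c k).
    by move=> v a b; rewrite -!compA => /(@kerm_monic A)/(@kerm_monic A).
  have [|m [mu _]] := proj2 (cokmP u) _ (cokm (i \c k)).
    transitivity (cokm (i \c k) \c (i \c q)); first by rewrite iq.
    by rewrite -[in i \c q](ker_liftK hq) (compA i) compA cokm0 comp0m.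
  have [|s [iks _]] := proj2 (monic_kernel_cok mk) _ i.
    by rewrite -mu -compA kerm0 compm0.
  have ks : k \c s = idm _.
    by apply: (@kerm_monic A); rewrite compA iks compm1.
  by rewrite -[h]compm1 -ks compA kerm0 comp0m.
have [t' it] : exists t', i \c t' = t by exists (ker_lift ut); apply: ker_liftK.
have [p [e [s [ee qs]]]] := epic_pullback t' eq.
exists p, e, s; split=> //; transitivity (i \c (q \c s)).
  by rewrite qs compA it.
by rewrite compA iq.
Qed.

End GeneralizedElements.

Section HomologyCriteria.
Variable A : abelian.
Implicit Types S T : short_complex A.

(* Injectivity and surjectivity in homology tested on generalized elements,
   which may be replaced by their restriction along an epimorphism. *)
Definition homology_inj S T (a : short_map S T) : Prop :=
  forall (w : A) (z : hom w (sc2 S)) (y : hom w (sc1 T)),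
    scg S \c z = 0 -> sm2 a \c z = scf T \c y ->
    exists (v : A) (e : hom v w) (u : hom v (sc1 S)),
      epic e /\ z \c e = scf S \c u.

Definition homology_surj S T (a : short_map S T) : Prop :=
  forall (w : A) (z : hom w (sc2 T)), scg T \c z = 0 ->
    exists (v : A) (e : hom v w) (s : hom v (sc2 S)) (u : hom v (sc1 T)),
      [/\ epic e, scg S \c s = 0 & z \c e = sm2 a \c s + scf T \c u].

Lemma homology_cycle S T (a : short_map S T) (w : A)
    (t : hom w (ker (scg S))) :
  homology_map a \c (cokm (ker_lift (scP S)) \c t) =
  cokm (ker_lift (scP T)) \c (cycle_map a \c t).
Proof.
have E : homology_map a \c cokm (ker_lift (scP S)) =
  cokm (ker_lift (scP T)) \c cycle_map a := cok_descK _.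
by rewrite !compA E.
Qed.

Lemma cycle_mapK S T (a : short_map S T) :
  kerm (scg T) \c cycle_map a = sm2 a \c kerm (scg S).
Proof. exact: ker_liftK. Qed.

Lemma homology_boundary S (w : A) (z : hom w (ker (scg S)))
    (u : hom w (sc1 S)) :
  kerm (scg S) \c z = scf S \c u -> cokm (ker_lift (scP S)) \c z = 0.
Proof.
move=> zu; have -> : z = ker_lift (scP S) \c u.
  by apply: (@kerm_monic A); rewrite zu compA ker_liftK.
by rewrite compA cokm0 comp0m.
Qed.

Lemma boundary_homology S (w : A) (z : hom w (ker (scg S))) :
  cokm (ker_lift (scP S)) \c z = 0 ->
  exists (v : A) (e : hom v w) (u : hom v (sc1 S)),
    epic e /\ kerm (scg S) \c (z \c e) = scf S \c u.
Proof.
move=> /(@cok_zero A)[v [e [u [ee zu]]]]; exists v, e, u; split=> //.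
by rewrite zu compA ker_liftK.
Qed.

Lemma homology_monicP S T (a : short_map S T) :
  monic (homology_map a) <-> homology_inj a.
Proof.
split=> [ma w z y gz zy|ai].
  have : cokm (ker_lift (scP S)) \c ker_lift gz = 0.
    apply: ma; rewrite compm0 homology_cycle.
    by apply: (homology_boundary (u := y)); rewrite compA cycle_mapK -compA ker_liftK.
  move=> /boundary_homology[v [e [u [ee zu]]]]; exists v, e, u; split=> //.
  by rewrite -zu compA ker_liftK.
apply: monicP => w m am.
(* Along an epimorphism, the homology class [m] lifts to a cycle [z]. *)
have [p [e [z [ee ze]]]] := epic_pullback m (@cokm_epic A _ _ (ker_lift (scP S))).
have : cokm (ker_lift (scP T)) \c (cycle_map a \c z) = 0.
  by rewrite -homology_cycle ze compA am comp0m.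
move=> /boundary_homology[v [e' [u [ee' zu]]]].
have [||q [e'' [s [ee'' zs]]]] := ai v (kerm (scg S) \c (z \c e')) u.
- by rewrite compA kerm0 comp0m.
- by rewrite -zu -compA [RHS]compA cycle_mapK -compA.
apply: (epic_comp ee (epic_comp ee' ee'')); rewrite comp0m.
rewrite !compA -ze -2!compA; apply: (homology_boundary (u := s)).
by rewrite -zs -!compA.
Qed.

Lemma homology_epicP S T (a : short_map S T) :
  epic (homology_map a) <-> homology_surj a.
Proof.
split=> [ea w z gz|ai].
  have [p [e [s [ee es]]]] := epic_pullback (cokm (ker_lift (scP T)) \c
    ker_lift gz) (epic_comp ea (@cokm_epic A _ _ (ker_lift (scP S)))).
  have : cokm (ker_lift (scP T)) \c (ker_lift gz \c e - cycle_map a \c s) = 0.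
    by rewrite compDr compmN -homology_cycle !compA es subrr.
  move=> /boundary_homology[v [e' [u [ee' zu]]]].
  exists v, (e \c e'), (kerm (scg S) \c s \c e'), u; split.
  - exact: epic_comp.
  - by rewrite !compA kerm0 !comp0m.
  rewrite -zu compDl compNm compDr compmN !compA ker_liftK cycle_mapK.
  by rewrite addrC subrK.
(* The universal cycle, the inclusion of the kernel, is the only one that has to be tested. *)
have [v [e [s [u [ee gs zu]]]]] := ai _ _ (kerm0 (scg T)).
apply: (@epicr A _ _ _ _ (cokm (ker_lift (scP S)) \c ker_lift gs)).
rewrite homology_cycle.
suff -> : cokm (ker_lift (scP T)) \c (cycle_map a \c ker_lift gs) =
    cokm (ker_lift (scP T)) \c e.
  by apply: epic_comp => //; apply: cokm_epic.
apply/eqP; rewrite eq_sym -subr_eq0 -compmN -compDr; apply/eqP.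
apply: (homology_boundary (u := u)).
by rewrite compDr compmN zu compA cycle_mapK -compA ker_liftK addrC addKr.
Qed.

Lemma homology_isoP S T (a : short_map S T) :
  is_iso (homology_map a) <-> homology_inj a /\ homology_surj a.
Proof.
by rewrite is_iso_monic_epic (propext (homology_monicP a))
  (propext (homology_epicP a)).
Qed.

End HomologyCriteria.

(** * Linear identities in abelian groups by reflection *)

Section ZmoduleReflection.

Inductive zterm := ZVar of nat | ZAdd of zterm & zterm | ZOpp of zterm | ZZero.

Fixpoint zeval (V : zmodType) (e : seq V) (t : zterm) : V :=
  match t with
  | ZVar i => e`_i
  | ZAdd s t => zeval e s + zeval e t
  | ZOpp t => - zeval e t
  | ZZero => 0
  end.

Fixpoint zcoef (t : zterm) (i : nat) : int :=
  match t with
  | ZVar j => (i == j)%:Z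
  | ZAdd s t => zcoef s i + zcoef t i
  | ZOpp t => - zcoef t i
  | ZZero => 0
  end.

Lemma zevalE (V : zmodType) (e : seq V) t :
  zeval e t = \sum_(i < size e) e`_i *~ zcoef t i.
Proof.
elim: t => [j|s IHs t IHt|t IHt|] /=.
(* A variable beyond the environment is read as the default 0, in agreement with the sum, which has
   no term for it. *)
- have [je|ej] := ltnP j (size e); last first.
    rewrite nth_default // big1 // => i _.
    by rewrite (ltn_eqF (leq_trans (ltn_ord i) ej)).
  rewrite (bigD1 (Ordinal je)) //= eqxx big1 ?addr0 // => i ij.
  by rewrite -val_eqE /= in ij; rewrite (negPf ij).
- by rewrite IHs IHt -big_split; apply: eq_bigr => i _; rewrite mulrzDr.
- by rewrite IHt -sumrN; apply: eq_bigr => i _; rewrite mulrNz.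
- by rewrite big1.
Qed.

Lemma zeval_eq (V : zmodType) (e : seq V) s t :
  all (fun i => zcoef s i == zcoef t i) (iota 0 (size e)) ->
  zeval e s = zeval e t.
Proof.
move=> /allP st; rewrite !zevalE; apply: eq_bigr => i _.
by rewrite (eqP (st i _)) // mem_iota ltn_ord.
Qed.

End ZmoduleReflection.

(** Continuation-passing style threads the environment, since quoting one summand may add atoms that
    the next one reuses. Atoms are compared with [unify], not syntactically. *)
Ltac zquote V e t k :=
  lazymatch t with
  | @Algebra.add _ ?a ?b =>
    zquote V e a ltac:(fun e a' => zquote V e b ltac:(fun e b' =>
      k e constr:(ZAdd a' b')))
  | @Algebra.opp _ ?a => zquote V e a ltac:(fun e a' => k e constr:(ZOpp a'))
  | @Algebra.zero _ => k e ZZero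
  | _ => zfind V e t ltac:(fun e i => k e constr:(ZVar i))
  end
with zfind V e t k :=
  lazymatch e with
  | nil => k constr:(@cons V t nil) O
  | cons ?x ?e' =>
    tryif unify x t then k e O
    else zfind V e' t ltac:(fun e' i => k constr:(@cons V x e') (S i))
  end.

(* Proves linear identities in a Z-module by comparing coefficients. *)
Ltac zmod :=
  lazymatch goal with
  | |- @eq ?T ?a ?b =>
    let V := constr:(GRing.Zmodule.clone T _) in
    zquote V constr:(@nil T) a ltac:(fun e s => zquote V e b ltac:(fun e t =>
      exact (@zeval_eq V e s t isT)))
  end.

(** * Cones and quasi-isomorphisms *)

Section Cones.
Variable A : abelian.
Implicit Types X Y : complex A.

Lemma cone_difE X Y (f : chain_map X Y) (n : int) :
  cone_dif f n = pair_m (- (dif X (n + 1) \c prl_m _ _))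
                        (f (n + 1) \c prl_m _ _ + dif Y n \c prr_m _ _).
Proof. by rewrite /pair_m -lock. Qed.

Lemma cmap_difA X Y (f : chain_map X Y) (n : int) (w : A) (t : hom w (X n)) :
  f (n + 1) \c (dif X n \c t) = dif Y n \c (f n \c t).
Proof. by rewrite compA cmap_dif -compA. Qed.

End Cones.

(** Matrix calculus in normal form: composites associate to the right, sums are expanded, and
    projections meet pairs and injections. The rules with a name in [A] catch a projection that
    meets its pair or injection inside a longer composite. *)
Ltac msimp :=
  do ?[progress rewrite /= ?cone_difE -?compA
    ?(prl_pair, prr_pair, prl_pairA, prr_pairA, prl_inl, prl_inr, prr_inl,
      prr_inr, prl_inlA, prl_inrA, prr_inlA, prr_inrA)
    ?(compDl, compDr, compNm, compmN, comp0m, compm0, comp1m, compm1)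
    ?(opprK, oppr0, addr0, add0r, opprD)].

Section ConeTheory.
Variable A : abelian.
Implicit Types X Y : complex A.

Lemma cone_difP X Y (f : chain_map X Y) (n : int) (w : A)
    (a : hom w (biprod (X (n + 1)) (Y n)))
    (b : hom w (biprod (X (n + 1 + 1)) (Y (n + 1)))) :
  cone_dif f n \c a = b <->
  - (dif X (n + 1) \c (prl_m _ _ \c a)) = prl_m _ _ \c b /\
  f (n + 1) \c (prl_m _ _ \c a) + dif Y n \c (prr_m _ _ \c a) = prr_m _ _ \c b.
Proof.
rewrite cone_difE; split=> [<-|[l r]]; first by split; msimp.
by apply: pair_ext; msimp; rewrite ?l ?r.
Qed.

Lemma cone_cycle X Y (f : chain_map X Y) (n : int) (w : A)
    (a : hom w (biprod (X (n + 1)) (Y n))) :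
  cone_dif f n \c a = 0 <->
  dif X (n + 1) \c (prl_m _ _ \c a) = 0 /\
  f (n + 1) \c (prl_m _ _ \c a) = - (dif Y n \c (prr_m _ _ \c a)).
Proof.
rewrite cone_difP !compm0; split=> [[l r]|[-> ->]]; last first.
  by split; rewrite ?oppr0 ?addNr.
split; apply/eqP; first by rewrite -oppr_eq0 l.
by rewrite -addr_eq0 r.
Qed.

Section ConeMap.
Variables (X Y X' Y' : complex A) (f : chain_map X Y) (f' : chain_map X' Y').
Variables (u : chain_map X X') (v : chain_map Y Y').
Hypothesis fuv : forall n, f' n \c u n = v n \c f n.

Lemma square_compA (n : int) (w : A) (t : hom w (X n)) :
  f' n \c (u n \c t) = v n \c (f n \c t).
Proof. by rewrite compA fuv -compA. Qed.

Definition cone_map : chain_map (cone f) (cone f').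
Proof.
exists (fun n => pair_m (u (n + 1) \c prl_m _ _) (v n \c prr_m _ _)) => n.
apply: pair_ext; msimp; first by rewrite cmap_difA.
by rewrite square_compA cmap_difA.
Defined.

(** A four lemma for H(X) -> H(Y) -> H(cone) -> H(X[1]), by a chase of generalized elements that
    needs no long exact sequence. A cycle of the cone is a pair [(x, y)] with [d x = 0] and
    [f x = - d y]; here its image is the boundary of [(x', y')]. *)
Lemma cone_map_inj (n : int) : homology_inj (chain_map_at u (n + 1)) ->
  homology_surj (chain_map_at u n) -> homology_inj (chain_map_at v n) ->
  homology_inj (chain_map_at cone_map n).
Proof.
move=> iu su iv w z b /= /cone_cycle[x0 xy] /esym/cone_difP[bx by'].
rewrite !(prl_pairA, prr_pairA) -!compA in bx by'.
suff [v0 [e [p [q [ee xp yq]]]]] : exists (v0 : A) (e : hom v0 w)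
    (p : hom v0 (X (n + 1))) (q : hom v0 (Y n)),
    [/\ epic e, (prl_m _ _ \c z) \c e = - (dif X (n + 1) \c p) &
        (prr_m _ _ \c z) \c e = f (n + 1) \c p + dif Y n \c q].
  exists v0, e, (pair_m p q); split=> //; apply/esym/cone_difP.
  by msimp; rewrite -xp -yq -!compA.
move: (prl_m _ _ \c z) (prr_m _ _ \c z) (prl_m _ _ \c b) (prr_m _ _ \c b)
  x0 xy bx by' => x y x' y' dx fx ux vy {z b}.
(* The first component of the bounding relation says that [u x] is the boundary of [- x']. *)
have [|v1 [e1 [r [ee1 xr]]]] := iu _ x (- x') dx; first by rewrite /= compmN ux.
rewrite /= in xr.
(* The chain [r] bounding [x] may be changed by a cycle. Taking [c] in the class of [u r + x'] makes
   [u (r - c)] equal to [- x'] up to the boundary of [s]. *)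
have [|v2 [e2 [c [s [ee2 dc rs]]]]] := su _ (u (n + 1) \c r + x' \c e1).
  rewrite /= compDr -cmap_difA -xr !compA -ux compNm -compA.
  by rewrite addNr.
rewrite /= in dc rs.
(* With this correction, [v] sends the cycle [y + f (r - c)] to the boundary of [f' s + y']. If [q]
   bounds that cycle, then [(c - r, q)] bounds [(x, y)]. *)
have [||v3 [e3 [q [ee3 yq]]]] := iv _
  (y \c e1 \c e2 + f (n + 1) \c (r \c e2 - c)) (f' n \c s + y' \c e1 \c e2).
- have fxA t (k : hom t w) : f (n + 1 + 1) \c (x \c k) = - (dif Y (n + 1) \c (y \c k)).
    by rewrite [LHS]compA fx compNm -compA.
  have xrA t (k : hom t v1) : dif X (n + 1) \c (r \c k) = x \c (e1 \c k).
    by rewrite [LHS]compA -xr -compA.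
  by rewrite /= !compDr -!cmap_difA compmN dc oppr0 compm0 addr0 xrA fxA -!compA subrr.
- have vyA t (k : hom t w) : v (n + 1) \c (y \c k) =
      f' (n + 1) \c (x' \c k) + dif Y' n \c (y' \c k).
    by rewrite [LHS]compA -vy compDl -!compA.
  have rsA : u (n + 1) \c (r \c e2) =
       u (n + 1) \c c + dif X' n \c s - x' \c (e1 \c e2).
    by rewrite -rs; msimp; rewrite addrK.
  rewrite /= -!compA !compDr !compmN -!square_compA vyA rsA -cmap_difA; msimp.
  zmod.
exists v3, (e1 \c (e2 \c e3)), (c \c e3 - r \c (e2 \c e3)), q; split.
- by apply: epic_comp => //; apply: epic_comp.
- by rewrite compDr compmN !compA dc xr !comp0m add0r opprK.
- have -> : dif Y n \c q = _ := esym yq.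
  by msimp; zmod.
Qed.

(** The other four lemma, for H(Y) -> H(cone) -> H(X[1]) -> H(Y[1]). *)
Lemma cone_map_surj (n : int) : homology_surj (chain_map_at u (n + 1)) ->
  homology_inj (chain_map_at v (n + 1)) -> homology_surj (chain_map_at v n) ->
  homology_surj (chain_map_at cone_map n).
Proof.
move=> su iv sv w z /= /cone_cycle[x0 xy].
suff [v0 [e [p [q [x [y [ee [dx fx] xp yq]]]]]]] : exists (v0 : A) (e : hom v0 w)
    (p : hom v0 (X' (n + 1))) (q : hom v0 (Y' n))
    (x : hom v0 (X (n + 1 + 1))) (y : hom v0 (Y (n + 1))),
    [/\ epic e, dif X (n + 1 + 1) \c x = 0 /\
        f (n + 1 + 1) \c x = - (dif Y (n + 1) \c y),
        (prl_m _ _ \c z) \c e = u (n + 1 + 1) \c x - dif X' (n + 1) \c p &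
        (prr_m _ _ \c z) \c e =
        v (n + 1) \c y + (f' (n + 1) \c p + dif Y' n \c q)].
  exists v0, e, (pair_m x y), (pair_m p q); split=> //.
    by apply/cone_cycle; msimp.
  by apply: pair_ext; msimp; rewrite compA.
move: (prl_m _ _ \c z) (prr_m _ _ \c z) x0 xy => x y dx fx {z}.
have [v1 [e1 [x1 [p [ee1 /= dx1 ux]]]]] := su _ x dx; rewrite /= in ux.
have fxA t' (k : hom t' w) :
    f' (n + 1 + 1) \c (x \c k) = - (dif Y' (n + 1) \c (y \c k)).
  by rewrite [LHS]compA fx compNm -compA.
(* The cycle [x1] lifts the class of [x]. To be completed to a cycle of the cone it needs [f x1] to
   bound, which holds because [v f x1 = f' (x - d p)] does. *)
have [||v2 [e2 [t [ee2 ft]]]] := iv _ (f (n + 1 + 1) \c x1)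
  (- (f' (n + 1) \c p + y \c e1)).
- by rewrite /= -cmap_difA dx1 compm0.
- rewrite /= -square_compA.
  have -> : u (n + 1 + 1) \c x1 = x \c e1 - dif X' (n + 1) \c p.
    rewrite ux; zmod.
  rewrite compDr compmN cmap_difA fxA; msimp; zmod.
rewrite /= in ft.
(* The pair [(x1, - t)] is now a cycle of the cone; what its image misses is a class coming from
   [Y'], hence from a cycle [c] of [Y]. *)
have [|v3 [e3 [c [s [ee3 dc ys]]]]] := sv _
  (v (n + 1) \c t + f' (n + 1) \c p \c e2 + y \c e1 \c e2).
  rewrite /= -!compA !compDr -!cmap_difA -ft -compA -square_compA.
  have uxA t' (k : hom t' v1) : u (n + 1 + 1) \c (x1 \c k) =
      x \c (e1 \c k) - dif X' (n + 1) \c (p \c k).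
    by rewrite [LHS]compA -[u _ \c x1](addrK (dif X' (n + 1) \c p)) -ux; msimp.
  by rewrite uxA compDr compmN fxA; zmod.
rewrite /= in dc ys.
exists v3, (e1 \c (e2 \c e3)), (- (p \c (e2 \c e3))), s,
  (x1 \c (e2 \c e3)), (c - t \c e3); split.
- by apply: epic_comp => //; apply: epic_comp.
- split; first by rewrite [LHS]compA dx1 comp0m.
  by rewrite compDr compmN dc !compA ft -!compA add0r opprK.
- by rewrite compA ux; msimp.
- rewrite compDr -[v _ \c c](addrK (dif Y' n \c s)) -ys; msimp; zmod.
Qed.

Lemma cone_map_quasi_iso : quasi_iso (u : @hom (complex_cat A) X X') ->
  quasi_iso (v : @hom (complex_cat A) Y Y') ->
  quasi_iso (cone_map : @hom (complex_cat A) (cone f) (cone f')).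
Proof.
move=> qu qv n; have /homology_isoP[iu su] := qu (n + 1).
have /homology_isoP[_ su'] := qu n; have /homology_isoP[iv _] := qv (n + 1).
have /homology_isoP[iv' sv] := qv n.
by apply/homology_isoP; split; [apply: cone_map_inj|apply: cone_map_surj].
Qed.

End ConeMap.

(** That the shift also reflects quasi-isomorphisms is what makes [unshift_functor] preserve
    them. *)
Lemma shift_quasi_isoP (X Y : complex_cat A) (f : hom X Y) :
  quasi_iso f <-> quasi_iso (fmap (shift_functor A) f).
Proof.
split=> [|qf n]; first exact: shift_quasi_iso.
have E m : homology_map (unshift_at Y m) \c homology_map (chain_map_at f (m + 1)) =
    homology_map (chain_map_at (fmap (shift_functor A) f) m) \c
    homology_map (unshift_at X m).
  by apply: homology_map_eq; rewrite /= compNm compmN comp1m compm1.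
have -> : n = n - 1 + 1 by rewrite subrK.
exact: (iso_square (unshift_atK X _) (shift_atK X _) (unshift_atK Y _)
  (shift_atK Y _) (qf (n - 1)) (E _)).
Qed.

Lemma is_iso_quasi_iso (X Y : complex_cat A) (f : hom X Y) :
  is_iso f -> quasi_iso f.
Proof.
move=> [g [gf fg]] n; exists (homology_map (chain_map_at g n)).
split; apply: homology_map_inv.
  exact: (congr1 (fun h : chain_map X X => h (n + 1)) gf).
exact: (congr1 (fun h : chain_map Y Y => h (n + 1)) fg).
Qed.

Lemma chain_map_iso (X Y : complex_cat A) (f : hom X Y) :
  (forall n : int, is_iso ((f : chain_map X Y) n)) -> is_iso f.
Proof.
move=> fi.
have gd (n : int) : inv_of (fi (n + 1)) \c dif Y n = dif X n \c inv_of (fi n).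
  by apply: inv_of_square; rewrite (cmap_dif f).
exists (ChainMap gd); split; apply: chain_mapP => n /=.
  exact: inv_ofK.
exact: inv_ofKV.
Qed.

(* For j the inclusion Y -> cone f, the cone of j is homotopy equivalent to
   X[1] by x |-> (f x, (- x, 0)). *)
Section ConeOfInclusion.
Variables (X Y : complex A) (f : chain_map X Y) (j : chain_map Y (cone f)).
Hypothesis jE : forall n, j n = inr_m _ _.

Definition cone_inclusion : chain_map (shift_complex X) (cone j).
Proof.
exists (fun n => pair_m (f (n + 1)) (pair_m (- idm _) 0)) => n.
apply: pair_ext; last apply: pair_ext.
- by msimp; rewrite cmap_dif.
- by msimp; rewrite jE; msimp.
- by msimp; rewrite jE; msimp; rewrite subrr.
Defined.

Lemma cone_inclusion_quasi_iso :
  quasi_iso (cone_inclusion : @hom (complex_cat A) (shift_complex X) (cone j)).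
Proof.
move=> n; apply/homology_isoP; split=> [w z b /= dz zb|w z /= dz].
- exists w, (idm w), (- (prl_m _ _ \c (prr_m _ _ \c b))); split; first exact: epic_id.
  have := congr1 (fun h => prl_m _ _ \c (prr_m _ _ \c h)) zb.
  msimp; rewrite jE; msimp.
  move/(congr1 -%R); rewrite !opprK => ->.
  by msimp.
- have [dg /esym/eqP] := (@cone_cycle _ _ j (n + 1) _ z).1 dz.
  rewrite eqr_oppLR jE -compmN => /eqP/(cone_difP f)[].
  msimp => dx yx.
  (* A cycle [(y, (x, y'))] satisfies [y = - (f x + d y')], so it is the image of [- x] plus the
     boundary of [(y', 0)]. *)
  exists w, (idm w), (- (prl_m _ _ \c (prr_m _ _ \c z))),
    (inl_m _ _ \c (prr_m _ _ \c (prr_m _ _ \c z))); split.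
  + exact: epic_id.
  + by rewrite compNm compmN opprK -[LHS]opprK dx oppr0.
  rewrite compm1; apply: pair_ext; last apply: pair_ext; msimp; rewrite ?jE; msimp => //.
  by rewrite -opprD yx opprK.
Qed.

End ConeOfInclusion.

(* For p the projection cone g -> Y[1], the cone of p is homotopy equivalent
   to X[1] by ((y, x), y') |-> x + g y'. *)
Section ConeOfProjection.
Variables (X Y : complex A) (g : chain_map Y X).
Variable p : chain_map (cone g) (shift_complex Y).
Hypothesis pE : forall n, p n = prl_m _ _.

Definition cone_projection : chain_map (cone p) (shift_complex X).
Proof.
exists (fun n => prr_m _ _ \c prl_m _ _ + g (n + 1) \c prr_m _ _) => n.
msimp; rewrite pE cmap_difA; msimp; zmod.
Defined.

Lemma cone_projection_quasi_iso :
  quasi_iso (cone_projection : @hom (complex_cat A) (cone p) (shift_complex X)).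
Proof.
move=> n; apply/homology_isoP; split=> [w z b /= dz zb|w z /= dz].
- have [dc /(congr1 -%R)] := (@cone_cycle _ _ p (n + 1) _ z).1 dz.
  rewrite pE /=; msimp => dg.
  (* For a cycle [((y, x), y')] one has [y = d y'], and the hypothesis reads [x + g y' = - d b];
     hence [((y', b), 0)] bounds it. *)
  exists w, (idm w), (pair_m (pair_m (prr_m _ _ \c z) b) 0); split.
    exact: epic_id.
  rewrite compm1; apply: pair_ext; first apply: pair_ext; msimp; rewrite ?pE; msimp => //.
    exact: oppr_inj dg.
  by move: zb; msimp => /(canRL (addrK _)) zb; exact: (etrans zb (addrC _ _)).
- exists w, (idm w), (inl_m _ _ \c (inr_m _ _ \c z)), 0; split.
  + exact: epic_id.
  + apply: pair_ext; first apply: pair_ext; msimp; rewrite ?pE; msimp => //.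
    by rewrite -compNm.
  + by msimp.
Qed.

End ConeOfProjection.
End ConeTheory.

(** * Inverse of the shift *)

Section QuasiIsoSquare.
Variable A : abelian.

Lemma quasi_iso_square (X X' Y Y' : complex_cat A) (u : hom X X') (v : hom Y Y')
    (p : hom X Y) (q : hom X' Y') :
  is_iso u -> is_iso v -> v \c p = q \c u -> quasi_iso q -> quasi_iso p.
Proof.
move=> [u' [u'u uu']] [v' [v'v vv']] E qq n.
have at_n (Z T : complex_cat A) (a b : hom Z T) : a = b ->
  (a : chain_map Z T) (n + 1) = (b : chain_map Z T) (n + 1) by move->.
apply: (iso_square (u := homology_map (chain_map_at u n))
  (u' := homology_map (chain_map_at u' n))
  (v := homology_map (chain_map_at v n))
  (v' := homology_map (chain_map_at v' n)) _ _ _ _ (qq n)).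
- by apply: homology_map_inv; apply: at_n u'u.
- by apply: homology_map_inv; apply: at_n uu'.
- by apply: homology_map_inv; apply: at_n v'v.
- by apply: homology_map_inv; apply: at_n vv'.
- by apply: homology_map_eq; apply: at_n E.
Qed.

End QuasiIsoSquare.

Section Unshift.
Variable A : abelian.
Implicit Types X Y : complex A.

(** The inverse shift meets the degrees [n - 1 + 1] and [n], which are equal but not convertible, so
    its differential has to be transported. *)
Definition cob_cast X (m n : int) (e : m = n) : hom (X m) (X n) :=
  match e in _ = k return hom (X m) (X k) with erefl => idm (X m) end.

Lemma cob_cast_id X (n : int) (e : n = n) : cob_cast X e = idm _.
Proof. by rewrite (Prop_irrelevance e erefl). Qed.

Lemma cob_cast_comp X (m n k : int) (e : m = n) (e' : n = k) (e'' : m = k) :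
  cob_cast X e' \c cob_cast X e = cob_cast X e''.
Proof. by case: k / e' e''; case: n / e => e; rewrite !cob_cast_id comp1m. Qed.

Lemma cob_cast_dif X (m n : int) (e : m = n) (e' : m + 1 = n + 1) :
  dif X n \c cob_cast X e = cob_cast X e' \c dif X m.
Proof. by case: n / e e' => e; rewrite !cob_cast_id compm1 comp1m. Qed.

Lemma cob_cast_map X Y (f : chain_map X Y) (m n : int) (e : m = n) :
  f n \c cob_cast X e = cob_cast Y e \c f m.
Proof. by case: n / e; rewrite !cob_cast_id compm1 comp1m. Qed.

Lemma cob_cast_shift X (m n : int) (e : m = n) (e' : m + 1 = n + 1) :
  cob_cast (shift_complex X) e = cob_cast X e' :> hom (X (m + 1)) (X (n + 1)).
Proof. by case: n / e e' => e; rewrite !cob_cast_id. Qed.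

Lemma is_iso_cob_cast X (m n : int) (e : m = n) : is_iso (cob_cast X e).
Proof. by case: n / e; apply: is_iso_id. Qed.

Fact addr1B (n : int) : n - 1 + 1 = n + 1 - 1.
Proof. by rewrite addrAC. Qed.

Definition unshift_complex X : complex A.
Proof.
exists (fun n => X (n - 1))
  (fun n => - (cob_cast X (addr1B n) \c dif X (n - 1))) => n.
rewrite compNm compmN opprK -compA (compA (dif X _)).
have e : n - 1 + 1 + 1 = n + 1 - 1 + 1 by rewrite addr1B.
by rewrite (cob_cast_dif _ _ e) -(compA (cob_cast X e)) dif2 !compm0.
Defined.

Definition unshift_map X Y (f : chain_map X Y) :
  chain_map (unshift_complex X) (unshift_complex Y).
Proof.
exists (fun n => f (n - 1)) => n /=.
by rewrite compmN compNm compA cob_cast_map -!compA cmap_dif.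
Defined.

Definition unshift_functor : functor (complex_cat A) (complex_cat A).
Proof.
exists (unshift_complex : complex_cat A -> complex_cat A) unshift_map.
- by move=> X; apply: chain_mapP.
- by move=> X Y Z g f; apply: chain_mapP.
Defined.

Fact addr1K (n : int) : n + 1 - 1 = n.
Proof. exact: addrK. Qed.

Fact subr1K (n : int) : n = n - 1 + 1.
Proof. by rewrite subrK. Qed.

Definition shift_unshift_map X :
  chain_map (shift_complex (unshift_complex X)) X.
Proof.
exists (fun n => cob_cast X (addr1K n)) => n /=.
rewrite opprK compA (cob_cast_comp _ _ _ (etrans (addr1B (n + 1)) (addr1K (n + 1)))).
exact/esym/cob_cast_dif.
Defined.

Definition shift_unshift :
  nat_trans (functor_comp (shift_functor A) (unshift_functor))
            (functor_id (complex_cat A)).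
Proof.
exists shift_unshift_map => X Y f; apply: chain_mapP => n /=.
exact/esym/cob_cast_map.
Defined.

Definition unshift_shift_map X :
  chain_map X (unshift_complex (shift_complex X)).
Proof.
exists (fun n => cob_cast X (subr1K n)) => n /=.
have e' : n - 1 + 1 + 1 = n + 1 - 1 + 1 by rewrite addr1B.
rewrite (cob_cast_shift _ _ e') compmN opprK -compA.
rewrite (cob_cast_dif _ _ (congr1 (+%R^~ 1) (subr1K n))) compA.
by rewrite (cob_cast_comp _ _ _ (subr1K (n + 1))).
Defined.

Definition unshift_shift :
  nat_trans (functor_id (complex_cat A))
            (functor_comp unshift_functor (shift_functor A)).
Proof.
exists unshift_shift_map => X Y f; apply: chain_mapP => n /=.
exact/esym/cob_cast_map.
Defined.

Lemma shift_unshift_iso X : is_iso (shift_unshift X).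
Proof. by apply: chain_map_iso => n; apply: is_iso_cob_cast. Qed.

Lemma unshift_shift_iso X : is_iso (unshift_shift X).
Proof. by apply: chain_map_iso => n; apply: is_iso_cob_cast. Qed.

(** After shifting, the map becomes isomorphic to [f]. *)
Lemma unshift_quasi_iso (X Y : complex_cat A) (f : hom X Y) :
  quasi_iso f -> quasi_iso (fmap unshift_functor f).
Proof.
move=> qf; apply/shift_quasi_isoP.
apply: (quasi_iso_square (shift_unshift_iso X) (shift_unshift_iso Y) _ qf).
exact: (naturality shift_unshift).
Qed.

End Unshift.

(** * Complexes of diagrams and diagrams of complexes *)

Section DiagramsOfComplexes.
Variables (C : category) (A : abelian).
Let AC : abelian := functor_abelian C A.
Let Ch : category := complex_cat A.

Definition at_ob (F G : AC) (a : hom F G) (p : C) :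
    hom ((F : functor C A) p) ((G : functor C A) p) := (a : nat_trans F G) p.

Lemma at_ob_iso (F G : AC) (a : hom F G) :
  (forall p, is_iso (at_ob a p)) <-> is_iso a.
Proof. exact: nat_isoP. Qed.

Section ShortComplexAt.
Variables (S T : short_complex AC) (a : short_map S T) (p : C).

Definition short_at (R : short_complex AC) : short_complex A :=
  ShortComplex (nat_ap p (scP R)).

Definition short_map_at : short_map (short_at S) (short_at T) :=
  @ShortMap A (short_at S) (short_at T) (at_ob (sm1 a) p) (at_ob (sm2 a) p)
    (at_ob (sm3 a) p) (nat_ap p (sm12 a)) (nat_ap p (sm23 a)).

(** Kernels of diagrams are pointwise by definition, but [ker_lift] is obtained by choice, so
    evaluation commutes with it only up to a proof. *)
Lemma ker_lift_at (R : short_complex AC) :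
  at_ob (ker_lift (scP R)) p = ker_lift (scP (short_at R)).
Proof.
apply: (@kerm_monic A _ _ (at_ob (scg R) p)); rewrite ker_liftK.
exact: (nat_ap p (ker_liftK (scP R))).
Qed.

Lemma cycle_map_at : at_ob (cycle_map a) p = cycle_map short_map_at.
Proof.
apply: (@kerm_monic A _ _ (at_ob (scg T) p)); rewrite [RHS]ker_liftK.
exact: (nat_ap p (cycle_mapK a)).
Qed.

(** Equal morphisms have cokernels that need not be convertible, so [h] and [h'] cannot be equated
    directly; only the property of being an isomorphism is carried over. *)
Lemma cok_map_iso (x y x' y' : A) (u u' : hom x y) (v v' : hom x' y')
    (c c' : hom y y') (h : hom (cok u) (cok v)) (h' : hom (cok u') (cok v')) :
  u = u' -> v = v' -> c = c' -> h \c cokm u = cokm v \c c ->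
  h' \c cokm u' = cokm v' \c c' -> is_iso h <-> is_iso h'.
Proof.
move=> uu' vv' cc'; case: u' / uu' h'; case: v' / vv' => h'.
by rewrite -cc' => <- /(@cokm_epic A) ->.
Qed.

Lemma homology_map_at_iso :
  is_iso (at_ob (homology_map a) p) <-> is_iso (homology_map short_map_at).
Proof.
apply: (cok_map_iso (ker_lift_at S) (ker_lift_at T) cycle_map_at).
  exact: (nat_ap p (cok_descK (homology_map_subproof a))).
exact: cok_descK.
Qed.

End ShortComplexAt.

Definition complex_ev (K : complex AC) (p : C) : complex A :=
  @Complex A (fun n => (K n : functor C A) p) (fun n => at_ob (dif K n) p)
    (fun n => nat_ap p (dif2 K n)).

Definition chain_ev (K L : complex AC) (f : chain_map K L) (p : C) :
    chain_map (complex_ev K p) (complex_ev L p) :=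
  @ChainMap A (complex_ev K p) (complex_ev L p) (fun n => at_ob (f n) p)
    (fun n => nat_ap p (cmap_dif f n)).

Lemma chain_ev_inj (K L : complex AC) (f g : chain_map K L) :
  (forall p n, chain_ev f p n = chain_ev g p n) -> f = g.
Proof.
by move=> fg; apply: chain_mapP => n; apply: nat_transP => p; apply: fg.
Qed.

(** Homology of diagrams is pointwise, and so is invertibility of a natural transformation. *)
Lemma pointwise_quasi_iso (K L : complex_cat AC) (f : hom K L) :
  quasi_iso f <-> forall p, quasi_iso (chain_ev f p : @hom Ch _ _).
Proof.
split=> [qf p n|qf n].
  apply: (homology_map_at_iso (chain_map_at f n) p).1.
  exact: (at_ob_iso (homology_map (chain_map_at f n))).2 (qf n) p.
apply: (at_ob_iso (homology_map (chain_map_at f n))).1 => p.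
exact: (homology_map_at_iso (chain_map_at f n) p).2 (qf p n).
Qed.

Lemma chain_ev_iso (K L : complex_cat AC) (f : hom K L) :
  (forall p n, is_iso (chain_ev f p n)) -> is_iso f.
Proof.
move=> fi; apply: chain_map_iso => n.
by apply: (at_ob_iso ((f : chain_map K L) n)).1 => p; apply: fi.
Qed.

Definition chain_of_family (K L : complex AC)
    (a : forall p, chain_map (complex_ev K p) (complex_ev L p))
    (an : forall p q (h : hom p q) n,
      a q n \c fmap (K n : functor C A) h = fmap (L n : functor C A) h \c a p n) :
    chain_map K L.
Proof.
exists (fun n => @NatTrans _ _ (K n) (L n) (fun p => a p n)
                  (fun p q h => an p q h n)) => n.
by apply: nat_transP => p; apply: (cmap_dif (a p)).
Defined.

Definition diagram_of_complex (K : complex AC) : functor C Ch.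
Proof.
exists (complex_ev K : C -> Ch) (fun p q h =>
  @ChainMap A (complex_ev K p) (complex_ev K q)
    (fun n => fmap (K n : functor C A) h)
    (fun n => esym (naturality (dif K n : nat_trans (K n) (K (n + 1))) h))).
- by move=> p; apply: chain_mapP => n /=; apply: fmap_id.
- by move=> p q r g h; apply: chain_mapP => n /=; apply: fmap_comp.
Defined.

Definition diagram_of_chain_map (K L : complex AC) (f : chain_map K L) :
  nat_trans (diagram_of_complex K) (diagram_of_complex L).
Proof.
exists (chain_ev f) => p q h; apply: chain_mapP => n.
exact: (naturality (f n : nat_trans (K n) (L n))).
Defined.

Definition diagrams_functor :
  functor (complex_cat AC) (functor_cat C Ch).
Proof.
exists (diagram_of_complex : complex_cat AC -> functor_cat C Ch)
  diagram_of_chain_map.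
- by move=> K; apply: nat_transP => p; apply: chain_mapP.
- by move=> K L M g f; apply: nat_transP => p; apply: chain_mapP.
Defined.

Lemma cmap_eq (X Y : Ch) (f g : hom X Y) n : f = g ->
  (f : chain_map X Y) n = (g : chain_map X Y) n.
Proof. by move->. Qed.

Definition diagram_degree (D : functor C Ch) (n : int) : functor C A :=
  @Functor C A (fun p => (D p : complex A) n)
    (fun p q h => (fmap D h : chain_map _ _) n)
    (fun p => cmap_eq n (fmap_id D p))
    (fun p q r g h => cmap_eq n (fmap_comp D g h)).

Definition diagram_dif (D : functor C Ch) (n : int) :
    nat_trans (diagram_degree D n) (diagram_degree D (n + 1)) :=
  @NatTrans C A (diagram_degree D n) (diagram_degree D (n + 1))
    (fun p => dif (D p) n)
    (fun p q h => esym (cmap_dif (fmap D h : chain_map _ _) n)).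

Definition complex_of_diagram (D : functor C Ch) : complex AC.
Proof.
exists (diagram_degree D) (diagram_dif D) => n.
by apply: nat_transP => p; apply: (dif2 (D p)).
Defined.

Definition complex_of_diagram_map (D E : functor C Ch) (t : nat_trans D E) :
  chain_map (complex_of_diagram D) (complex_of_diagram E).
Proof.
apply: (@chain_of_family (complex_of_diagram D) (complex_of_diagram E)
  (fun p => @ChainMap A (complex_ev (complex_of_diagram D) p)
     (complex_ev (complex_of_diagram E) p) (t p : chain_map _ _)
     (cmap_dif (t p : chain_map _ _)))) => p q h n.
exact: (cmap_eq n (naturality t h)).
Defined.

Definition complexes_functor :
  functor (functor_cat C Ch) (complex_cat AC).
Proof.
exists (complex_of_diagram : functor_cat C Ch -> complex_cat AC)
  complex_of_diagram_map.
- by move=> D; apply: chain_ev_inj.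
- by move=> D E G u t; apply: chain_ev_inj.
Defined.

(* The objects and differentials of (complex_of_diagram D) at p are those of
   (D p), but the two complexes carry different proofs. *)
Definition complex_of_diagramK (D : functor C Ch) :
  nat_trans (diagram_of_complex (complex_of_diagram D)) D.
Proof.
exists (fun p => @ChainMap A (complex_ev (complex_of_diagram D) p) (D p)
  (fun n => idm _) (fun n => etrans (comp1m _) (esym (compm1 _)))) => p q h.
by apply: chain_mapP => n /=; rewrite comp1m compm1.
Defined.

Definition complex_of_diagramKV (D : functor C Ch) :
  nat_trans D (diagram_of_complex (complex_of_diagram D)).
Proof.
exists (fun p => @ChainMap A (D p) (complex_ev (complex_of_diagram D) p)
  (fun n => idm _) (fun n => etrans (comp1m _) (esym (compm1 _)))) => p q h.
by apply: chain_mapP => n /=; rewrite comp1m compm1.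
Defined.

Lemma complex_of_diagramK_iso (D : functor C Ch) :
  is_iso (complex_of_diagramK D : @hom (functor_cat C Ch) _ _).
Proof. by apply/nat_isoP => p; apply: chain_map_iso => n; apply: is_iso_id. Qed.

Lemma complex_of_diagramKV_iso (D : functor C Ch) :
  is_iso (complex_of_diagramKV D : @hom (functor_cat C Ch) _ _).
Proof. by apply/nat_isoP => p; apply: chain_map_iso => n; apply: is_iso_id. Qed.

Lemma complex_of_diagram_quasi_iso (D E : functor C Ch) (t : nat_trans D E) :
  (forall p, quasi_iso (t p)) ->
  quasi_iso (complex_of_diagram_map t : @hom (complex_cat AC) _ _).
Proof.
move=> qt; apply/pointwise_quasi_iso => p.
apply: (quasi_iso_square (u := complex_of_diagramK D p)
  (v := complex_of_diagramK E p) _ _ _ (qt p)).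
- by have /nat_isoP := complex_of_diagramK_iso D; apply.
- by have /nat_isoP := complex_of_diagramK_iso E; apply.
- by apply: chain_mapP => n /=; rewrite comp1m compm1.
Qed.

Definition shift_diagram (D : functor C Ch) : functor C Ch :=
  functor_comp (shift_functor A) D.

(** Source and target differ only in the proofs that their functors and complexes carry; hence
    identities as components. *)
Definition complex_of_shift (K : complex AC) :
  chain_map (complex_of_diagram (shift_diagram (diagram_of_complex K)))
            (shift_complex K).
Proof.
apply: (@chain_of_family _ _ (fun p => @ChainMap A
  (complex_ev (complex_of_diagram (shift_diagram (diagram_of_complex K))) p)
  (complex_ev (shift_complex K) p)
  (fun n => idm _) (fun n => etrans (comp1m _) (esym (compm1 _))))) => p q h n.
by rewrite /= comp1m compm1.
Defined.

Definition shift_of_complex (K : complex AC) :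
  chain_map (shift_complex K)
    (complex_of_diagram (shift_diagram (diagram_of_complex K))).
Proof.
apply: (@chain_of_family _ _ (fun p => @ChainMap A
  (complex_ev (shift_complex K) p)
  (complex_ev (complex_of_diagram (shift_diagram (diagram_of_complex K))) p)
  (fun n => idm _) (fun n => etrans (comp1m _) (esym (compm1 _))))) => p q h n.
by rewrite /= comp1m compm1.
Defined.

Lemma complex_of_shift_iso (K : complex AC) :
  is_iso (complex_of_shift K : @hom (complex_cat AC) _ _).
Proof. by apply: chain_ev_iso => p n; apply: is_iso_id. Qed.

Lemma shift_of_complex_iso (K : complex AC) :
  is_iso (shift_of_complex K : @hom (complex_cat AC) _ _).
Proof. by apply: chain_ev_iso => p n; apply: is_iso_id. Qed.

End DiagramsOfComplexes.

(** * The cone functors between the two glueings *)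

Lemma cone_map_ext (A : abelian) (Z X Y : complex_cat A)
    (f : chain_map X Y) (g h : @hom (complex_cat A) Z (cone f)) :
  (forall n, prl_m _ _ \c (g : chain_map _ _) n = prl_m _ _ \c (h : chain_map _ _) n) ->
  (forall n, prr_m _ _ \c (g : chain_map _ _) n = prr_m _ _ \c (h : chain_map _ _) n) ->
  g = h.
Proof. by move=> l r; apply: chain_mapP => n; apply: pair_ext. Qed.

Lemma naturality_at (C : category) (A : abelian)
    (D D' : functor C (complex_cat A)) (t : nat_trans D D') (p q : C)
    (h : hom p q) n :
  (t q : chain_map _ _) n \c (fmap D h : chain_map _ _) n =
  (fmap D' h : chain_map _ _) n \c (t p : chain_map _ _) n.
Proof. exact: (cmap_eq n (naturality t h)). Qed.

Section PosetFunctors.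
Variables (d : Order.disp_t) (P : porderType d) (A : abelian).
Variable D : functor (poset_cat P) (complex_cat A).

Lemma poset_fmap_comp (p q r : poset_cat P) (a : hom p q) (b : hom q r)
    (c : hom p r) :
  fmap D b \c fmap D a = fmap D c.
Proof. by rewrite -fmap_comp; congr fmap; apply: bool_irrelevance. Qed.

Lemma poset_fmap_at (p q r : poset_cat P) (a : hom p q) (b : hom q r)
    (c : hom p r) n :
  (fmap D c : chain_map _ _) n =
  (fmap D b : chain_map _ _) n \c (fmap D a : chain_map _ _) n.
Proof. by rewrite -(poset_fmap_comp a b c). Qed.

Lemma poset_fmap_id (p : poset_cat P) (a : hom p p) : fmap D a = idm _.
Proof. by rewrite -fmap_id; congr fmap; apply: bool_irrelevance. Qed.

Lemma poset_fmap_square (p q q' r : poset_cat P) (a : hom p q) (b : hom q r)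
    (a' : hom p q') (b' : hom q' r) n :
  (fmap D b : chain_map _ _) n \c (fmap D a : chain_map _ _) n =
  (fmap D b' : chain_map _ _) n \c (fmap D a' : chain_map _ _) n.
Proof. by rewrite -!(poset_fmap_at _ _ (b \c a)). Qed.

End PosetFunctors.

Section Glueing.
Variables (d d' : Order.disp_t) (X : finPOrderType d) (Y : finPOrderType d').
Variables (f : X -> Y) (f_homo : {homo f : x x' / (x <= x')%O}) (A : abelian).
Let Ch : category := complex_cat A.
Let Plus : category := poset_cat (glue_plus f_homo).
Let Minus : category := poset_cat (glue_minus f_homo).

(** Both posets have the carrier [X + Y]; these names fix in which of them an element or a relation
    is meant. *)
Definition plus_l (x : X) : Plus := inl x.
Definition plus_r (y : Y) : Plus := inr y.
Definition minus_l (x : X) : Minus := inl x.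
Definition minus_r (y : Y) : Minus := inr y.

Definition plus_ll x x' (h : (x <= x')%O) : hom (plus_l x) (plus_l x') := h.
Definition plus_rr y y' (h : (y <= y')%O) : hom (plus_r y) (plus_r y') := h.
Definition plus_lr x y (h : (f x <= y)%O) : hom (plus_l x) (plus_r y) := h.
Definition minus_ll x x' (h : (x <= x')%O) : hom (minus_l x) (minus_l x') := h.
Definition minus_rr y y' (h : (y <= y')%O) : hom (minus_r y) (minus_r y') := h.
Definition minus_rl x y (h : (y <= f x)%O) : hom (minus_r y) (minus_l x) := h.

(** The component at [x] of the map phi : F -> f^* G. *)
Definition plus_edge (D : functor Plus Ch) (x : X) :
    chain_map (D (plus_l x)) (D (plus_r (f x))) :=
  fmap D (plus_lr (lexx (f x))).

Definition minus_edge (E : functor Minus Ch) (x : X) :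
    chain_map (E (minus_r (f x))) (E (minus_l x)) :=
  fmap E (minus_rl (lexx (f x))).

Section PlusToMinus.
Variable D : functor Plus Ch.

Definition to_minus_ob (p : Minus) : Ch :=
  match p with
  | inl x => cone (plus_edge D x)
  | inr y => D (plus_r y)
  end.

Definition to_minus_ll x x' (h : (x <= x')%O) :
    chain_map (cone (plus_edge D x)) (cone (plus_edge D x')) :=
  cone_map (u := fmap D (plus_ll h)) (v := fmap D (plus_rr (f_homo h)))
    (fun n => poset_fmap_square _ _ _ _ _ n).

Definition to_minus_fmap (p q : Minus) :
    hom p q -> hom (to_minus_ob p) (to_minus_ob q) :=
  match p as p', q as q'
    return @hom Minus p' q' -> hom (to_minus_ob p') (to_minus_ob q') with
  | inl x, inl x' => fun h => to_minus_ll h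
  | inl x, inr y => fun h => False_rect _ (notF h)
  | inr y, inl x => fun h =>
      (cone_inr (plus_edge D x) : hom (D (plus_r (f x)) : Ch) _)
        \c fmap D (plus_rr h)
  | inr y, inr y' => fun h => fmap D (plus_rr h)
  end.

Definition to_minus : functor Minus Ch.
Proof.
exists to_minus_ob to_minus_fmap.
- case=> [x|y] /=; last exact: poset_fmap_id.
  by apply: cone_map_ext => n; msimp; rewrite poset_fmap_id /= comp1m.
- case=> [x|y] [x'|y'] [x''|y''] // g h.
  + apply: cone_map_ext => n; msimp.
      by rewrite (poset_fmap_at _ (plus_ll h) (plus_ll g)) -compA.
    by rewrite (poset_fmap_at _ (plus_rr (f_homo h)) (plus_rr (f_homo g))) -compA.
  + apply: cone_map_ext => n; msimp => //.
    exact: (poset_fmap_at _ (plus_rr h) (plus_rr (f_homo g))).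
  + apply: (etrans _ (compA _ _ _)); congr (_ \c _).
    exact/esym/poset_fmap_comp.
  + exact/esym/poset_fmap_comp.
Defined.

End PlusToMinus.

Section PlusToMinusMap.
Variables (D D' : functor Plus Ch) (t : nat_trans D D').

Definition to_minus_comp (p : Minus) : hom (to_minus D p) (to_minus D' p) :=
  match p as p' return hom (to_minus D p') (to_minus D' p') with
  | inl x => cone_map (u := t (plus_l x)) (v := t (plus_r (f x)))
      (fun n => esym (naturality_at t (plus_lr (lexx (f x))) n))
  | inr y => t (plus_r y)
  end.

Definition to_minus_map : nat_trans (to_minus D) (to_minus D').
Proof.
exists to_minus_comp.
case=> [x|y] [x'|y'] // h.
- apply: cone_map_ext => n; msimp.
    by rewrite !compA naturality_at.
  by rewrite !compA naturality_at.
- apply: cone_map_ext => n; msimp => //.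
  exact: naturality_at.
- exact: (naturality t (plus_rr h)).
Defined.

End PlusToMinusMap.

Definition to_minus_functor : functor (functor_cat Plus Ch) (functor_cat Minus Ch).
Proof.
exists (to_minus : functor_cat Plus Ch -> functor_cat Minus Ch) to_minus_map.
- move=> D; apply: nat_transP => -[x|y] //.
  by apply: cone_map_ext => n; msimp.
- move=> D D' D'' t u; apply: nat_transP => -[x|y] //.
  by apply: cone_map_ext => n; msimp.
Defined.

Section MinusToPlus.
Variable E : functor Minus Ch.

Definition to_plus_ob (p : Plus) : Ch :=
  match p with
  | inl x => cone (minus_edge E x)
  | inr y => shift_complex (E (minus_r y))
  end.

Definition to_plus_ll x x' (h : (x <= x')%O) :
    chain_map (cone (minus_edge E x)) (cone (minus_edge E x')) :=
  cone_map (u := fmap E (minus_rr (f_homo h))) (v := fmap E (minus_ll h))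
    (fun n => poset_fmap_square _ _ _ _ _ n).

Definition to_plus_fmap (p q : Plus) :
    hom p q -> hom (to_plus_ob p) (to_plus_ob q) :=
  match p as p', q as q'
    return @hom Plus p' q' -> hom (to_plus_ob p') (to_plus_ob q') with
  | inl x, inl x' => fun h => to_plus_ll h
  | inl x, inr y => fun h =>
      fmap (shift_functor A) (fmap E (minus_rr h))
        \c (cone_prl (minus_edge E x) : @hom Ch _ _)
  | inr y, inl x => fun h => False_rect _ (notF h)
  | inr y, inr y' => fun h => fmap (shift_functor A) (fmap E (minus_rr h))
  end.

Definition to_plus : functor Plus Ch.
Proof.
exists to_plus_ob to_plus_fmap.
- case=> [x|y] /=.
    by apply: cone_map_ext => n; msimp; rewrite poset_fmap_id /= comp1m.
  by rewrite poset_fmap_id; apply: (fmap_id (shift_functor A)).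
- case=> [x|y] [x'|y'] [x''|y''] // g h.
  + apply: cone_map_ext => n; msimp.
      by rewrite (poset_fmap_at _ (minus_rr (f_homo h)) (minus_rr (f_homo g))) -compA.
    by rewrite (poset_fmap_at _ (minus_ll h) (minus_ll g)) -compA.
  + apply: chain_mapP => n; msimp.
    by rewrite (poset_fmap_at _ (minus_rr (f_homo h)) (minus_rr g)) -compA.
  + rewrite [RHS]compA; congr (_ \c _).
    by rewrite -fmap_comp; congr fmap; apply/esym/poset_fmap_comp.
  + apply: chain_mapP => n.
    exact: (poset_fmap_at _ (minus_rr h) (minus_rr g)).
Defined.

End MinusToPlus.

Section MinusToPlusMap.
Variables (E E' : functor Minus Ch) (t : nat_trans E E').

Definition to_plus_comp (p : Plus) : hom (to_plus E p) (to_plus E' p) :=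
  match p as p' return hom (to_plus E p') (to_plus E' p') with
  | inl x => cone_map (u := t (minus_r (f x))) (v := t (minus_l x))
      (fun n => esym (naturality_at t (minus_rl (lexx (f x))) n))
  | inr y => fmap (shift_functor A) (t (minus_r y))
  end.

Definition to_plus_map : nat_trans (to_plus E) (to_plus E').
Proof.
exists to_plus_comp.
case=> [x|y] [x'|y'] // h.
- apply: cone_map_ext => n; msimp.
    by rewrite !compA naturality_at.
  by rewrite !compA naturality_at.
- apply: chain_mapP => n; msimp.
  by rewrite !compA naturality_at.
- by apply: chain_mapP => n; apply: (naturality_at t (minus_rr h)).
Defined.

End MinusToPlusMap.

Definition to_plus_functor : functor (functor_cat Minus Ch) (functor_cat Plus Ch).
Proof.
exists (to_plus : functor_cat Minus Ch -> functor_cat Plus Ch) to_plus_map.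
- move=> D; apply: nat_transP => -[x|y].
    by apply: cone_map_ext => n; msimp.
  exact: (fmap_id (shift_functor A)).
- move=> D D' D'' t u; apply: nat_transP => -[x|y].
    by apply: cone_map_ext => n; msimp.
  exact: (fmap_comp (shift_functor A)).
Defined.

End Glueing.

(** * Equivalences of derived categories from functors of complexes *)

Lemma fmap_square (C D : category) (F : functor C D) (x y y' z : C)
    (g : hom y z) (f : hom x y) (g' : hom y' z) (f' : hom x y') :
  g \c f = g' \c f' -> fmap F g \c fmap F f = fmap F g' \c fmap F f'.
Proof. by rewrite -!fmap_comp => ->. Qed.

Section DerivedEquivalence.
Variables A B : abelian.
Let ChA : category := complex_cat A.
Let ChB : category := complex_cat B.
Variables (F : functor ChA ChB) (G : functor ChB ChA).
Hypothesis FQ : forall (X Y : ChA) (w : hom X Y), quasi_iso w -> quasi_iso (fmap F w).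
Hypothesis GQ : forall (X Y : ChB) (w : hom X Y), quasi_iso w -> quasi_iso (fmap G w).

Variable kappa : nat_trans (functor_comp F G) (shift_functor B).
Hypothesis kappaQ : forall X, quasi_iso (kappa X).
Variable theta : nat_trans (shift_functor A) (functor_comp G F).
Hypothesis thetaQ : forall X, quasi_iso (theta X).

Let DF : functor (derived_cat A) (derived_cat B) := localized FQ.
Let DG : functor (derived_cat B) (derived_cat A) := localized GQ.
Let DUA : functor (derived_cat A) (derived_cat A) := localized (@unshift_quasi_iso A).
Let DUB : functor (derived_cat B) (derived_cat B) := localized (@unshift_quasi_iso B).

Lemma to_derived_iso (C : abelian) (X Y : complex_cat C) (w : hom X Y) :
  quasi_iso w -> is_iso (fmap (to_derived C) w).
Proof. exact: loc_functor_iso. Qed.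

Lemma to_derived_comp_iso (C : abelian) (X Y Z : complex_cat C) (g : hom Y Z)
    (f : hom X Y) :
  quasi_iso g -> quasi_iso f -> is_iso (fmap (to_derived C) (g \c f)).
Proof.
by move=> qg qf; rewrite fmap_comp; apply: is_iso_comp; apply: to_derived_iso.
Qed.

Lemma DF_mor (X Y : ChA) (f : hom X Y) :
  fmap DF (fmap (to_derived A) f) = fmap (to_derived B) (fmap F f).
Proof. exact: localized_mor. Qed.

Lemma DG_mor (X Y : ChB) (f : hom X Y) :
  fmap DG (fmap (to_derived B) f) = fmap (to_derived A) (fmap G f).
Proof. exact: localized_mor. Qed.

Lemma DUA_mor (X Y : ChA) (f : hom X Y) :
  fmap DUA (fmap (to_derived A) f) =
  fmap (to_derived A) (fmap (unshift_functor A) f).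
Proof. exact: localized_mor. Qed.

Lemma DUB_mor (X Y : ChB) (f : hom X Y) :
  fmap DUB (fmap (to_derived B) f) =
  fmap (to_derived B) (fmap (unshift_functor B) f).
Proof. exact: localized_mor. Qed.

Lemma derived_shift_mor (C : abelian) (X Y : complex_cat C) (f : hom X Y) :
  fmap (derived_shift C) (fmap (to_derived C) f) =
  fmap (to_derived C) (fmap (shift_functor C) f).
Proof. exact: loc_endofunctor_mor. Qed.

Definition derived_counit :
  nat_trans (functor_comp DF (functor_comp DG DUB)) (functor_id (derived_cat B)).
Proof.
exists (fun X => fmap (to_derived B)
  ((shift_unshift B X : hom _ (X : ChB)) \c kappa (unshift_functor B X))).
apply: loc_naturality => X Y f.
have E : fmap DF (fmap DG (fmap DUB (fmap (to_derived B) f))) =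
    fmap (to_derived B) (fmap F (fmap G (fmap (unshift_functor B) f))).
  by rewrite DUB_mor DG_mor DF_mor.
apply: (etrans (congr1 (comp _) E)).
apply: (fmap_square (to_derived B)).
rewrite -compA (naturality kappa) compA.
by rewrite (naturality (shift_unshift B)) -compA.
Defined.

Definition derived_unit :
  nat_trans (functor_id (derived_cat A)) (functor_comp (functor_comp DUA DG) DF).
Proof.
exists (fun X => fmap (to_derived A)
  (fmap (unshift_functor A) (theta X) \c (unshift_shift A X : hom (X : ChA) _))).
apply: loc_naturality => X Y f.
have E : fmap DUA (fmap DG (fmap DF (fmap (to_derived A) f))) =
    fmap (to_derived A) (fmap (unshift_functor A) (fmap G (fmap F f))).
  by rewrite DF_mor DG_mor DUA_mor.
apply: (etrans _ (congr1 (comp^~ _) (esym E))).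
apply: (fmap_square (to_derived A)).
rewrite -compA (naturality (unshift_shift A)) !compA.
apply: (congr1 (comp^~ _)); apply: (fmap_square (unshift_functor A)).
exact: (naturality theta).
Defined.

(** Unshifting before [DG] gives a right quasi-inverse, unshifting after [DG] a left one. Going
    through [two_sided_equivalence] avoids comparing the two by a commutation of [G] with the
    shift. *)
Lemma derived_equivalence : is_equivalence DF.
Proof.
apply: (two_sided_equivalence (eps := derived_counit) (eta := derived_unit)) => X.
  apply: (to_derived_comp_iso (g := shift_unshift B X)
    (f := kappa (unshift_functor B X))); last exact: kappaQ.
  by apply: is_iso_quasi_iso; apply: shift_unshift_iso.
apply: (to_derived_comp_iso (g := fmap (unshift_functor A) (theta X))
  (f := unshift_shift A X)).
  by apply: unshift_quasi_iso; apply: thetaQ.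
by apply: is_iso_quasi_iso; apply: unshift_shift_iso.
Qed.

Variable phi : nat_trans (functor_comp F (shift_functor A))
                         (functor_comp (shift_functor B) F).
Hypothesis phi_iso : forall X, is_iso (phi X).
Variable sigma : forall (X Y : ChA) (f : hom X Y),
  @hom ChB (F (cone f : ChA)) (cone (fmap F f)).
Hypothesis sigma_iso : forall X Y (f : @hom ChA X Y), is_iso (sigma f).
Hypothesis sigma_inr : forall X Y (f : @hom ChA X Y),
  sigma f \c fmap F (cone_inr f : hom Y (cone f : ChA)) =
  (cone_inr (fmap F f) : @hom ChB _ _).
Hypothesis sigma_prl : forall X Y (f : @hom ChA X Y),
  (cone_prl (fmap F f) : @hom ChB _ (shift_functor B (F X))) \c sigma f =
  phi X \c fmap F (cone_prl f : hom (cone f : ChA) (shift_functor A X)).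

Definition derived_phi :
  nat_trans (functor_comp DF (translation (derived A)))
            (functor_comp (translation (derived B)) DF).
Proof.
exists (fun X => fmap (to_derived B) (phi X)).
apply: loc_naturality => X Y f.
have E : fmap DF (fmap (derived_shift A) (fmap (to_derived A) f)) =
    fmap (to_derived B) (fmap F (fmap (shift_functor A) f)).
  by rewrite derived_shift_mor DF_mor.
have E' : fmap (derived_shift B) (fmap DF (fmap (to_derived A) f)) =
    fmap (to_derived B) (fmap (shift_functor B) (fmap F f)).
  by rewrite DF_mor derived_shift_mor.
apply: (etrans (congr1 (comp _) E)).
apply: (etrans _ (congr1 (comp^~ _) (esym E'))).
apply: (fmap_square (to_derived B)).
exact: (naturality phi).
Defined.

(** Distinguished triangles are those isomorphic to a cone triangle, and [sigma] identifies the
    image of the cone triangle of [f] with the cone triangle of [fmap F f]. *)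
Lemma derived_triangle_equivalence :
  triangle_equivalent (derived A) (derived B).
Proof.
exists DF, derived_phi; split.
- exact: derived_equivalence.
- by move=> X; apply: to_derived_iso; apply: (is_iso_quasi_iso (phi_iso X)).
move=> x y z u v w [X [Y [f [a [b [c [[ai bi ci] [bu cv aw]]]]]]]].
exists (F X), (F Y), (fmap F f), (fmap DF a), (fmap DF b),
  (fmap (to_derived B) (sigma f) \c fmap DF c); split; split.
- exact: is_iso_fmap.
- exact: is_iso_fmap.
- apply: is_iso_comp; last exact: is_iso_fmap.
  by apply: to_derived_iso; apply: (is_iso_quasi_iso (sigma_iso f)).
- by rewrite -DF_mor; apply: fmap_square.
- rewrite -compA -sigma_inr [fmap _ (sigma f \c _)]fmap_comp -compA -DF_mor.
  by apply: (congr1 (comp _)); apply: fmap_square.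
- rewrite [RHS]compA -[fmap _ _ \c fmap _ (sigma f)]fmap_comp sigma_prl.
  rewrite [fmap _ (phi X \c _)]fmap_comp -DF_mor -[RHS]compA -fmap_comp -aw.
  rewrite [fmap DF (_ \c _)]fmap_comp [RHS]compA [LHS]compA.
  (* Here [a] is a morphism of the derived category and not a chain map, so naturality is used on
     the localization. *)
  by apply: (congr1 (comp^~ _)); apply/esym/(naturality derived_phi).
Qed.

End DerivedEquivalence.

(** * Both composites of the cone functors are the shift *)

Section ConjugateTransformations.
Variables K1 K2 F1 F2 : category.
Variables (d1 : functor K1 F1) (c1 : functor F1 K1).
Variables (d2 : functor K2 F2) (c2 : functor F2 K2).
Variables (t : functor F1 F2) (u : functor F2 F1).

Definition stable_by_iso (K : category) (W : forall x y : K, hom x y -> Prop) :=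
  forall (x x' y' y : K) (u : hom x x') (q : hom x' y') (v : hom y' y),
    is_iso u -> is_iso v -> W _ _ q -> W _ _ (v \c (q \c u)).

Section Lower.
Variables (S : functor F2 F2) (T : functor K2 K2).
Variable rho : nat_trans (functor_comp d1 c1) (functor_id F1).
Variable k : nat_trans (functor_comp t u) S.
Variable s : nat_trans (functor_comp c2 (functor_comp S d2)) T.

(** Think of [K1], [K2] as complexes of diagrams, of [F1], [F2] as diagrams of complexes, and of
    [d], [c] as the passages between them. The pasting is [c2 t d1 c1 u d2 -> c2 t u d2 -> c2 S d2
    -> T]. *)
Definition lower_conjugate : nat_trans
  (functor_comp (functor_comp c2 (functor_comp t d1))
                (functor_comp c1 (functor_comp u d2))) T.
Proof.
exists (fun K => s K \c (fmap c2 (k (d2 K)) \c fmap c2 (fmap t (rho (u (d2 K)))))).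
move=> K L w /=; rewrite -!compA.
rewrite -[fmap c2 _ \c fmap c2 (fmap t _)]fmap_comp -[fmap t _ \c _]fmap_comp.
rewrite (naturality rho (fmap u (fmap d2 w))) /= 2!fmap_comp.
rewrite (compA _ (fmap c2 (fmap t (fmap u _)))) -fmap_comp.
rewrite (naturality k (fmap d2 w)) /= fmap_comp !compA.
by rewrite (naturality s w).
Defined.

Lemma lower_conjugate_stable W K : stable_by_iso W ->
  is_iso (rho (u (d2 K))) -> is_iso (s K) -> W _ _ (fmap c2 (k (d2 K))) ->
  W _ _ (lower_conjugate K).
Proof.
move=> Wi ri si Wk.
exact: (Wi _ _ _ _ _ _ _ (is_iso_fmap c2 (is_iso_fmap t ri)) si Wk).
Qed.

End Lower.

Section Upper.
Variables (S : functor F1 F1) (T : functor K1 K1).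
Variable rho : nat_trans (functor_id F2) (functor_comp d2 c2).
Variable k : nat_trans S (functor_comp u t).
Variable s : nat_trans T (functor_comp c1 (functor_comp S d1)).

Definition upper_conjugate : nat_trans T
  (functor_comp (functor_comp c1 (functor_comp u d2))
                (functor_comp c2 (functor_comp t d1))).
Proof.
exists (fun K => fmap c1 (fmap u (rho (t (d1 K)))) \c (fmap c1 (k (d1 K)) \c s K)).
move=> K L w /=; rewrite -!compA (naturality s w) /=.
rewrite (compA _ (fmap c1 (fmap S _))) -fmap_comp (naturality k (fmap d1 w)) /=.
rewrite fmap_comp !compA -!fmap_comp.
by rewrite (naturality rho (fmap t (fmap d1 w))).
Defined.

Lemma upper_conjugate_stable W K : stable_by_iso W ->
  is_iso (rho (t (d1 K))) -> is_iso (s K) -> W _ _ (fmap c1 (k (d1 K))) ->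
  W _ _ (upper_conjugate K).
Proof.
move=> Wi ri si Wk.
exact: (Wi _ _ _ _ _ _ _ si (is_iso_fmap c1 (is_iso_fmap u ri)) Wk).
Qed.

End Upper.
End ConjugateTransformations.

Lemma quasi_iso_stable (A : abelian) : stable_by_iso (@quasi_iso A).
Proof.
move=> X X' Y' Y u q v ui vi; apply: (quasi_iso_square ui (is_iso_inv_of vi)).
by rewrite compA inv_ofK comp1m.
Qed.

Section DiagramNaturality.
Variables (C : category) (A : abelian).
Let Ch : category := complex_cat A.
Let AC : abelian := functor_abelian C A.

Definition collapse : nat_trans
  (functor_comp (diagrams_functor C A) (complexes_functor C A))
  (functor_id (functor_cat C Ch)).
Proof.
exists (@complex_of_diagramK C A) => D E t.
apply: nat_transP => p; apply: chain_mapP => n.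
exact: (etrans (comp1m _) (esym (compm1 _))).
Defined.

Definition expand : nat_trans (functor_id (functor_cat C Ch))
  (functor_comp (diagrams_functor C A) (complexes_functor C A)).
Proof.
exists (@complex_of_diagramKV C A) => D E t.
apply: nat_transP => p; apply: chain_mapP => n.
exact: (etrans (comp1m _) (esym (compm1 _))).
Defined.

Lemma collapse_iso D : is_iso (collapse D).
Proof. exact: complex_of_diagramK_iso. Qed.

Lemma expand_iso D : is_iso (expand D).
Proof. exact: complex_of_diagramKV_iso. Qed.

Definition shift_diagram_map (D E : functor C Ch) (t : nat_trans D E) :
  nat_trans (shift_diagram D) (shift_diagram E).
Proof.
exists (fun p => fmap (shift_functor A) (t p)) => p q h.
exact: (fmap_square (shift_functor A) (naturality t h)).
Defined.

Definition shift_diagrams_functor :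
  functor (functor_cat C Ch) (functor_cat C Ch).
Proof.
exists (@shift_diagram C A : functor_cat C Ch -> functor_cat C Ch)
  shift_diagram_map.
- by move=> D; apply: nat_transP => p; apply: (fmap_id (shift_functor A)).
- by move=> D E G g f; apply: nat_transP => p; apply: (fmap_comp (shift_functor A)).
Defined.

Definition from_shift : nat_trans
  (functor_comp (complexes_functor C A)
    (functor_comp shift_diagrams_functor (diagrams_functor C A)))
  (shift_functor AC).
Proof.
exists (@complex_of_shift C A) => K L w.
by apply: chain_ev_inj => p n; apply: (etrans (comp1m _) (esym (compm1 _))).
Defined.

Definition to_shift : nat_trans (shift_functor AC)
  (functor_comp (complexes_functor C A)
    (functor_comp shift_diagrams_functor (diagrams_functor C A))).
Proof.
exists (@shift_of_complex C A) => K L w.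
by apply: chain_ev_inj => p n; apply: (etrans (comp1m _) (esym (compm1 _))).
Defined.

End DiagramNaturality.

Section GlueingEquivalence.
Variables (d d' : Order.disp_t) (X : finPOrderType d) (Y : finPOrderType d').
Variables (f : X -> Y) (f_homo : {homo f : x x' / (x <= x')%O}) (A : abelian).
Let Ch : category := complex_cat A.
Let Plus : category := poset_cat (glue_plus f_homo).
Let Minus : category := poset_cat (glue_minus f_homo).

(** The edge is [cone_inr] composed with the image of a reflexive relation, which is an identity
    only up to a proof. This is why [cone_inclusion] takes the inclusion as a variable known through
    its components. *)
Lemma minus_edge_to_minus (D : functor Plus Ch) (x : X) n :
  minus_edge (to_minus D) x n = inr_m _ _.
Proof.
by rewrite /minus_edge /= (poset_fmap_id D (plus_rr f_homo (lexx (f x)))) /= compm1.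
Qed.

Lemma plus_edge_to_plus (E : functor Minus Ch) (x : X) n :
  plus_edge (to_plus E) x n = prl_m _ _.
Proof.
by rewrite /plus_edge /= (poset_fmap_id E (minus_rr f_homo (lexx (f x)))) /= comp1m.
Qed.

Section ThetaDiagram.
Variable D : functor Plus Ch.

Definition theta_comp (p : Plus) :
    hom (shift_diagram D p) (to_plus (to_minus D) p) :=
  match p as p' return hom (shift_diagram D p') (to_plus (to_minus D) p') with
  | inl x => cone_inclusion (minus_edge_to_minus D x)
  | inr y => idm (shift_complex (D (plus_r f_homo y)) : Ch)
  end.

(** The direction matters: [cone_inclusion] followed by the projection to Y[1] is exactly the
    shifted edge, whereas the homotopy inverse [(y, (x, y')) |-> - x] commutes with the edges only
    up to homotopy. *)
Definition theta_diagram : nat_trans (shift_diagram D) (to_plus (to_minus D)).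
Proof.
exists theta_comp.
case=> [x|y] [x'|y'] // h.
- apply: cone_map_ext => n; msimp.
    exact: esym (poset_fmap_square _ _ _ _ _ _).
  by apply: pair_ext; msimp.
- apply: chain_mapP => n; msimp.
  by rewrite (poset_fmap_at _ (plus_lr f_homo (lexx (f x))) (plus_rr f_homo h)).
- exact: (etrans (comp1m _) (esym (compm1 _))).
Defined.

Lemma theta_diagram_quasi_iso p : quasi_iso (theta_diagram p).
Proof.
case: p => [x|y]; first exact: cone_inclusion_quasi_iso.
exact/is_iso_quasi_iso/is_iso_id.
Qed.

End ThetaDiagram.

Lemma theta_diagram_natural (D D' : functor Plus Ch) (t : nat_trans D D') p :
  theta_diagram D' p \c fmap (shift_functor A) (t p) =
  to_plus_map (to_minus_map t) p \c theta_diagram D p.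
Proof.
case: p => [x|y]; last exact: (etrans (comp1m _) (esym (compm1 _))).
apply: cone_map_ext => n; msimp.
  exact: (esym (naturality_at t _ _)).
by apply: pair_ext; msimp.
Qed.

Section KappaDiagram.
Variable E : functor Minus Ch.

Definition kappa_comp (p : Minus) :
    hom (to_minus (to_plus E) p) (shift_diagram E p) :=
  match p as p' return hom (to_minus (to_plus E) p') (shift_diagram E p') with
  | inl x => cone_projection (plus_edge_to_plus E x)
  | inr y => idm (shift_complex (E (minus_r f_homo y)) : Ch)
  end.

(** Again only one direction is strict: [cone_projection] restricts to the shifted edge on the
    summand Y[1], while its homotopy inverse [x |-> ((0, x), 0)] respects the edges only up to
    homotopy. *)
Definition kappa_diagram : nat_trans (to_minus (to_plus E)) (shift_diagram E).
Proof.
exists kappa_comp.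
case=> [x|y] [x'|y'] // h.
- apply: chain_mapP => n; msimp; congr (_ + _).
  by rewrite !compA; congr (_ \c _); apply: poset_fmap_square.
- apply: chain_mapP => n; msimp.
  by rewrite (poset_fmap_at _ (minus_rr f_homo h) (minus_rl f_homo (lexx (f x')))).
- exact: (etrans (comp1m _) (esym (compm1 _))).
Defined.

Lemma kappa_diagram_quasi_iso p : quasi_iso (kappa_diagram p).
Proof.
case: p => [x|y]; first exact: cone_projection_quasi_iso.
exact/is_iso_quasi_iso/is_iso_id.
Qed.

End KappaDiagram.

Lemma kappa_diagram_natural (E E' : functor Minus Ch) (t : nat_trans E E') p :
  kappa_diagram E' p \c to_minus_map (to_plus_map t) p =
  fmap (shift_functor A) (t p) \c kappa_diagram E p.
Proof.
case: p => [x|y]; last exact: (etrans (comp1m _) (esym (compm1 _))).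
apply: chain_mapP => n; msimp; congr (_ + _).
by rewrite !compA; congr (_ \c _); apply/esym/naturality_at.
Qed.

Let DP : abelian := functor_abelian Plus A.
Let DM : abelian := functor_abelian Minus A.

Definition plus_minus : functor (complex_cat DP) (complex_cat DM) :=
  functor_comp (complexes_functor Minus A)
    (functor_comp (to_minus_functor f_homo A) (diagrams_functor Plus A)).

Definition minus_plus : functor (complex_cat DM) (complex_cat DP) :=
  functor_comp (complexes_functor Plus A)
    (functor_comp (to_plus_functor f_homo A) (diagrams_functor Minus A)).

Lemma plus_minus_quasi_iso (K L : complex_cat DP) (w : hom K L) :
  quasi_iso w -> quasi_iso (fmap plus_minus w).
Proof.
move=> /pointwise_quasi_iso qw; apply: complex_of_diagram_quasi_iso.
case=> [x|y] /=; last exact: qw.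
by apply: cone_map_quasi_iso; apply: qw.
Qed.

Lemma minus_plus_quasi_iso (K L : complex_cat DM) (w : hom K L) :
  quasi_iso w -> quasi_iso (fmap minus_plus w).
Proof.
move=> /pointwise_quasi_iso qw; apply: complex_of_diagram_quasi_iso.
case=> [x|y] /=; last by apply: shift_quasi_iso; apply: qw.
by apply: cone_map_quasi_iso; apply: qw.
Qed.

Definition kappa_diagrams : nat_trans
  (functor_comp (to_minus_functor f_homo A) (to_plus_functor f_homo A))
  (shift_diagrams_functor Minus A).
Proof.
exists kappa_diagram => D E t.
by apply: nat_transP => p; apply: kappa_diagram_natural.
Defined.

Definition theta_diagrams : nat_trans (shift_diagrams_functor Plus A)
  (functor_comp (to_plus_functor f_homo A) (to_minus_functor f_homo A)).
Proof.
exists theta_diagram => D E t.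
by apply: nat_transP => p; apply: theta_diagram_natural.
Defined.

Definition kappa :
    nat_trans (functor_comp plus_minus minus_plus) (shift_functor DM) :=
  lower_conjugate (collapse Plus A) kappa_diagrams (from_shift Minus A).

Lemma kappa_quasi_iso K : quasi_iso (kappa K).
Proof.
apply: (lower_conjugate_stable (@quasi_iso_stable DM)).
- exact: collapse_iso.
- exact: complex_of_shift_iso.
- exact/complex_of_diagram_quasi_iso/kappa_diagram_quasi_iso.
Qed.

Definition theta :
    nat_trans (shift_functor DP) (functor_comp minus_plus plus_minus) :=
  upper_conjugate (expand Minus A) theta_diagrams (to_shift Plus A).

Lemma theta_quasi_iso K : quasi_iso (theta K).
Proof.
apply: (upper_conjugate_stable (@quasi_iso_stable DP)).
- exact: expand_iso.
- exact: shift_of_complex_iso.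
- exact/complex_of_diagram_quasi_iso/theta_diagram_quasi_iso.
Qed.

End GlueingEquivalence.

(** * Compatibility with cones *)

Lemma idm_square (C : category) (x y : C) (a b : hom x y) :
  a = b -> idm y \c a = b \c idm x.
Proof. by move=> ->; rewrite comp1m compm1. Qed.

Section Swap.
Variable A : abelian.

(** Of the two maps leaving [a] in an iterated cone, the one belonging to the inner cone acquires a
    minus sign from the outer differential. Negating [a] moves that sign to the other map when the
    cones are exchanged. *)
Definition biswap (a b c d : A) :
    hom (biprod (biprod a b) (biprod c d)) (biprod (biprod a c) (biprod b d)) :=
  pair_m
    (pair_m (- (prl_m _ _ \c prl_m _ _)) (prl_m _ _ \c prr_m _ _))
    (pair_m (prr_m _ _ \c prl_m _ _) (prr_m _ _ \c prr_m _ _)).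

Lemma biswapK (a b c d : A) : biswap a c b d \c biswap a b c d = idm _.
Proof. by apply: pair_ext; apply: pair_ext; rewrite /biswap; msimp. Qed.

Lemma biswap_iso (a b c d : A) : is_iso (biswap a b c d).
Proof. by exists (biswap a c b d); rewrite !biswapK. Qed.

Lemma biprod_mapE (x y x' y' : A) (a : hom x x') (b : hom y y') :
  biprod_map a b = pair_m (a \c prl_m _ _) (b \c prr_m _ _).
Proof. by rewrite /biprod_map /pair_m -lock !compA. Qed.

(* The two iterated cones of a square are its total complex, up to the sign
   of the first component. *)
Lemma biswap_cone (a b c d a' b' c' d' : A)
    (da : hom a a') (db : hom b b') (dc : hom c c') (dd : hom d d')
    (ab : hom a b') (cd : hom c d') (ac : hom a c') (bd : hom b d') :
  let cone_of x y x' y' (dx : hom x x') (dy : hom y y') (h : hom x y') :=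
    pair_m (- (dx \c prl_m x y)) (h \c prl_m x y + dy \c prr_m x y) in
  let diag x y x' y' (u : hom x x') (v : hom y y') :=
    pair_m (u \c prl_m x y) (v \c prr_m x y) in
  biswap a' b' c' d' \c
    cone_of _ _ _ _ (cone_of _ _ _ _ da db ab) (cone_of _ _ _ _ dc dd cd)
      (diag _ _ _ _ ac bd) =
  cone_of _ _ _ _ (cone_of _ _ _ _ da dc ac) (cone_of _ _ _ _ db dd bd)
      (diag _ _ _ _ ab cd)
    \c biswap a b c d.
Proof.
rewrite /biswap /=.
by apply: pair_ext; apply: pair_ext; msimp => //; zmod.
Qed.

Lemma biswap_diag (a b c d a' b' c' d' : A)
    (u : hom a a') (v : hom b b') (w : hom c c') (z : hom d d') :
  biswap a' b' c' d' \c
    pair_m (pair_m (u \c prl_m _ _) (v \c prr_m _ _) \c prl_m _ _)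
      (pair_m (w \c prl_m _ _) (z \c prr_m _ _) \c prr_m _ _) =
  pair_m (pair_m (u \c prl_m _ _) (w \c prr_m _ _) \c prl_m _ _)
    (pair_m (v \c prl_m _ _) (z \c prr_m _ _) \c prr_m _ _) \c biswap a b c d.
Proof. by apply: pair_ext; apply: pair_ext; rewrite /biswap; msimp. Qed.

Lemma biswap_inr (a b c d : A) :
  biswap a b c d \c pair_m (inr_m _ _ \c prl_m _ _) (inr_m _ _ \c prr_m _ _) =
  inr_m _ _.
Proof. by apply: pair_ext; apply: pair_ext; rewrite /biswap; msimp. Qed.

Lemma biswap_inr_diag (a b c d c' d' : A) (u : hom c' c) (v : hom d' d) :
  biswap a b c d \c (inr_m _ _ \c pair_m (u \c prl_m _ _) (v \c prr_m _ _)) =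
  pair_m ((inr_m a c \c u) \c prl_m _ _) ((inr_m b d \c v) \c prr_m _ _) \c idm _.
Proof. by apply: pair_ext; apply: pair_ext; rewrite /biswap; msimp. Qed.

Definition bisign (a b : A) : hom (biprod a b) (biprod a b) :=
  pair_m (- idm a \c prl_m a b) (idm b \c prr_m a b).

Lemma bisign_iso (a b : A) : is_iso (bisign a b).
Proof.
by exists (bisign a b); split; apply: pair_ext; rewrite /bisign; msimp.
Qed.

Lemma bisign_cone (a b a' b' : A) (da : hom a a') (db : hom b b') (h : hom a b') :
  bisign a' b' \c
    pair_m (- (- da \c prl_m _ _)) (h \c prl_m _ _ + - db \c prr_m _ _) =
  - pair_m (- (da \c prl_m _ _)) (h \c prl_m _ _ + db \c prr_m _ _)
    \c bisign a b.
Proof. by apply: pair_ext; rewrite /bisign; msimp. Qed.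

Lemma bisign_diag (a b a' b' : A) (u : hom a a') (v : hom b b') :
  bisign a' b' \c pair_m (u \c prl_m _ _) (v \c prr_m _ _) =
  pair_m (u \c prl_m _ _) (v \c prr_m _ _) \c bisign a b.
Proof. by apply: pair_ext; rewrite /bisign; msimp. Qed.

Lemma bisign_inr (a b b' : A) (v : hom b' b) :
  bisign a b \c (inr_m a b \c v) = (inr_m a b \c v) \c idm b'.
Proof. by apply: pair_ext; rewrite /bisign; msimp. Qed.

(** The sign of [biswap] is exactly the one that [bisign] puts on the doubly shifted summand, so the
    third maps of the two triangles agree with no leftover sign. *)
Lemma biswap_prl (a b c d : A) :
  prl_m _ _ \c biswap a b c d =
  bisign _ _ \c pair_m (prl_m _ _ \c prl_m _ _) (prl_m _ _ \c prr_m _ _).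
Proof. by apply: pair_ext; rewrite /biswap /bisign; msimp. Qed.

End Swap.

Section ConeCompatibility.
Variables (d d' : Order.disp_t) (X : finPOrderType d) (Y : finPOrderType d').
Variables (f : X -> Y) (f_homo : {homo f : x x' / (x <= x')%O}) (A : abelian).
Let Ch : category := complex_cat A.
Let Plus : category := poset_cat (glue_plus f_homo).
Let Minus : category := poset_cat (glue_minus f_homo).

Let DP : abelian := functor_abelian Plus A.
Let DM : abelian := functor_abelian Minus A.
Local Notation PM := (plus_minus f_homo A).

(** Up to conversion this is [cone_difE]. Such matrix forms reduce each compatibility below to an
    identity between explicit maps of biproducts. *)
Lemma dif_plus_minus (K : complex_cat DP) (x : X) n :
  at_ob (dif (PM K) n) (minus_l f_homo x) =
  pair_m (- (at_ob (dif K (n + 1)) (plus_l f_homo x) \c prl_m _ _))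
    (fmap (K (n + 1) : functor Plus A) (plus_lr f_homo (lexx (f x))) \c prl_m _ _ +
     at_ob (dif K n) (plus_r f_homo (f x)) \c prr_m _ _).
Proof. exact: (cone_difE (plus_edge (diagram_of_complex K) x) n). Qed.

Lemma at_ob_cone (C : category) (F F' G G' : functor_abelian C A) (p : C)
    (a : hom F F') (b : hom F G') (c : hom G G') :
  at_ob (inl_m _ _ \c (- (a \c prl_m _ _)) +
         inr_m _ _ \c (b \c prl_m _ _ + c \c prr_m _ _)) p =
  pair_m (- (at_ob a p \c prl_m _ _))
    (at_ob b p \c prl_m _ _ + at_ob c p \c prr_m _ _).
Proof. by rewrite /pair_m -lock. Qed.

Lemma dif_cone_at (C : category) (K L : complex_cat (functor_abelian C A))
    (w : hom K L) (p : C) n :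
  at_ob (dif (cone w) n) p =
  pair_m (- (at_ob (dif K (n + 1)) p \c prl_m _ _))
    (at_ob ((w : chain_map K L) (n + 1)) p \c prl_m _ _ + at_ob (dif L n) p \c prr_m _ _).
Proof.
exact: (at_ob_cone p (dif K (n + 1)) ((w : chain_map K L) (n + 1)) (dif L n)).
Qed.

Lemma fmap_cone_at (C : category) (K L : complex_cat (functor_abelian C A))
    (w : hom K L) (p q : C) (h : hom p q) n :
  fmap (cone w n : functor C A) h =
  pair_m (fmap (K (n + 1) : functor C A) h \c prl_m _ _)
    (fmap (L n : functor C A) h \c prr_m _ _).
Proof. exact: biprod_mapE. Qed.

Lemma plus_minus_map_at (K L : complex_cat DP) (w : hom K L) (x : X) n :
  at_ob ((fmap PM w : chain_map _ _) n) (minus_l f_homo x) =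
  pair_m (at_ob ((w : chain_map K L) (n + 1)) (plus_l f_homo x) \c prl_m _ _)
    (at_ob ((w : chain_map K L) n) (plus_r f_homo (f x)) \c prr_m _ _).
Proof. by []. Qed.

Lemma plus_minus_cone_dif (K L : complex_cat DP) (w : hom K L) (x : X) n :
  biswap _ _ _ _ \c at_ob (dif (PM (cone w)) n) (minus_l f_homo x) =
  at_ob (dif (cone (fmap PM w)) n) (minus_l f_homo x) \c biswap _ _ _ _.
Proof.
rewrite (dif_plus_minus (cone w)) (fmap_cone_at w).
rewrite !(dif_cone_at w).
rewrite (dif_cone_at (fmap PM w)).
rewrite (dif_plus_minus K) (dif_plus_minus L) (plus_minus_map_at w).
exact: biswap_cone.
Qed.

Lemma dif_plus_minus_r (K : complex_cat DP) (y : Y) n :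
  at_ob (dif K n) (plus_r f_homo y) = at_ob (dif (PM K) n) (minus_r f_homo y).
Proof. by []. Qed.

Lemma fmap_plus_minus_ll (K : complex_cat DP) (x x' : X) (h : (x <= x')%O) n :
  fmap (PM K n : functor Minus A) (minus_ll f_homo h) =
  pair_m (fmap (K (n + 1) : functor Plus A) (plus_ll f_homo h) \c prl_m _ _)
    (fmap (K n : functor Plus A) (plus_rr f_homo (f_homo h)) \c prr_m _ _).
Proof. by []. Qed.

Lemma fmap_plus_minus_rl (K : complex_cat DP) (x : X) (y : Y) (h : (y <= f x)%O) n :
  fmap (PM K n : functor Minus A) (minus_rl f_homo h) =
  inr_m ((K (n + 1) : functor Plus A) (plus_l f_homo x)) _ \c
    fmap (K n : functor Plus A) (plus_rr f_homo h).
Proof. by []. Qed.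

Lemma fmap_plus_minus_rr (K : complex_cat DP) (y y' : Y) (h : (y <= y')%O) n :
  fmap (K n : functor Plus A) (plus_rr f_homo h) =
  fmap (PM K n : functor Minus A) (minus_rr f_homo h).
Proof. by []. Qed.

Lemma dif_shift_at (C : category) (K : complex_cat (functor_abelian C A))
    (p : C) n :
  at_ob (dif (shift_complex K) n) p = - at_ob (dif K (n + 1)) p.
Proof. by []. Qed.

Section ShiftCompatibility.
Variables (K : complex_cat DP) (n : int).
Let KL m (x : X) := (K m : functor Plus A) (plus_l f_homo x).
Let KR m (y : Y) := (K m : functor Plus A) (plus_r f_homo y).

Lemma plus_minus_shift_dif_l (x : X) :
  bisign (KL (n + 1 + 1 + 1) x) (KR (n + 1 + 1) (f x)) \c
    at_ob (dif (PM (shift_complex K)) n) (minus_l f_homo x) =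
  at_ob (dif (shift_complex (PM K)) n) (minus_l f_homo x) \c
    bisign (KL (n + 1 + 1) x) (KR (n + 1) (f x)).
Proof.
rewrite (dif_plus_minus (shift_complex K)) (dif_shift_at (PM K)).
rewrite !(dif_shift_at K) (dif_plus_minus K).
exact: bisign_cone.
Qed.

Lemma plus_minus_shift_dif_r (y : Y) :
  @eq (hom (KR (n + 1) y) (KR (n + 1 + 1) y))
    (at_ob (dif (PM (shift_complex K)) n) (minus_r f_homo y))
    (at_ob (dif (shift_complex (PM K)) n) (minus_r f_homo y)).
Proof.
(* Both sides equal [M], minus the differential of [K] over [y]; every link of the chain is stated
   at the common type [T]. *)
pose T := hom (KR (n + 1) y) (KR (n + 1 + 1) y).
pose M : T := - at_ob (dif K (n + 1)) (plus_r f_homo y).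
have e1 : @eq T M (at_ob (dif (PM (shift_complex K)) n) (minus_r f_homo y)) :=
  dif_plus_minus_r (shift_complex K) y n.
have e2 : @eq T (- at_ob (dif (PM K) (n + 1)) (minus_r f_homo y)) M :=
  congr1 (fun e : T => - e) (esym (dif_plus_minus_r K y (n + 1))).
have e3 : @eq T (at_ob (dif (shift_complex (PM K)) n) (minus_r f_homo y))
  (- at_ob (dif (PM K) (n + 1)) (minus_r f_homo y)) :=
  dif_shift_at (PM K) (minus_r f_homo y) n.
exact: (etrans (esym e1) (esym (etrans e3 e2))).
Qed.

Lemma plus_minus_shift_ll (x x' : X) (h : (x <= x')%O) :
  bisign (KL (n + 1 + 1) x') (KR (n + 1) (f x')) \c
    fmap (PM (shift_complex K) n : functor Minus A) (minus_ll f_homo h) =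
  fmap (PM K (n + 1) : functor Minus A) (minus_ll f_homo h) \c
    bisign (KL (n + 1 + 1) x) (KR (n + 1) (f x)).
Proof.
rewrite (fmap_plus_minus_ll (shift_complex K)) (fmap_plus_minus_ll K).
exact: bisign_diag.
Qed.

Lemma plus_minus_shift_rl (x : X) (y : Y) (h : (y <= f x)%O) :
  bisign (KL (n + 1 + 1) x) (KR (n + 1) (f x)) \c
    fmap (PM (shift_complex K) n : functor Minus A) (minus_rl f_homo h) =
  fmap (PM K (n + 1) : functor Minus A) (minus_rl f_homo h) \c idm (KR (n + 1) y).
Proof.
rewrite (fmap_plus_minus_rl (shift_complex K)) (fmap_plus_minus_rl K).
exact: bisign_inr.
Qed.

Lemma plus_minus_shift_rr (y y' : Y) (h : (y <= y')%O) :
  @eq (hom (KR (n + 1) y) (KR (n + 1) y'))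
    (fmap (PM (shift_complex K) n : functor Minus A) (minus_rr f_homo h))
    (fmap (PM K (n + 1) : functor Minus A) (minus_rr f_homo h)).
Proof.
pose T := hom (KR (n + 1) y) (KR (n + 1) y').
have e1 : @eq T (fmap (K (n + 1) : functor Plus A) (plus_rr f_homo h))
  (fmap (PM (shift_complex K) n : functor Minus A) (minus_rr f_homo h)) :=
  fmap_plus_minus_rr (shift_complex K) h n.
have e2 : @eq T (fmap (K (n + 1) : functor Plus A) (plus_rr f_homo h))
  (fmap (PM K (n + 1) : functor Minus A) (minus_rr f_homo h)) :=
  fmap_plus_minus_rr K h (n + 1).
exact: (etrans (esym e1) e2).
Qed.

End ShiftCompatibility.

(* The shift changes the sign of the differential but not of phi, whence the
   sign on the first summand of the cone. *)
Definition plus_minus_shift_at (K : complex_cat DP) (p : Minus) :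
  chain_map (complex_ev (PM (shift_complex K)) p)
            (complex_ev (shift_complex (PM K)) p).
Proof.
case: p => [x|y].
  exists (fun n => bisign ((K (n + 1 + 1) : functor Plus A) (plus_l f_homo x))
    ((K (n + 1) : functor Plus A) (plus_r f_homo (f x)))) => n.
  exact (plus_minus_shift_dif_l K n x).
exists (fun n => idm ((K (n + 1) : functor Plus A) (plus_r f_homo y))) => n.
exact (idm_square (plus_minus_shift_dif_r K n y)).
Defined.

Definition plus_minus_shift_map (K : complex_cat DP) :
  chain_map (PM (shift_complex K)) (shift_complex (PM K)).
Proof.
apply: (chain_of_family (a := plus_minus_shift_at K)).
case=> [x|y] [x'|y'] // h n.
- exact (plus_minus_shift_ll K n h).
- exact (plus_minus_shift_rl K n h).
- exact (idm_square (plus_minus_shift_rr K n h)).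
Defined.

Lemma plus_minus_shift_natural_l (K L : complex_cat DP) (w : hom K L) n (x : X) :
  bisign ((L (n + 1 + 1) : functor Plus A) (plus_l f_homo x))
      ((L (n + 1) : functor Plus A) (plus_r f_homo (f x))) \c
    at_ob ((fmap PM (fmap (shift_functor DP) w) : chain_map _ _) n)
      (minus_l f_homo x) =
  at_ob ((fmap PM w : chain_map _ _) (n + 1)) (minus_l f_homo x) \c
    bisign ((K (n + 1 + 1) : functor Plus A) (plus_l f_homo x))
      ((K (n + 1) : functor Plus A) (plus_r f_homo (f x))).
Proof.
rewrite (plus_minus_map_at (fmap (shift_functor DP) w)) (plus_minus_map_at w).
exact: bisign_diag.
Qed.

Lemma plus_minus_shift_natural_r (K L : complex_cat DP) (w : hom K L) n (y : Y) :
  @eq (hom ((K (n + 1) : functor Plus A) (plus_r f_homo y))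
           ((L (n + 1) : functor Plus A) (plus_r f_homo y)))
    (at_ob ((fmap PM (fmap (shift_functor DP) w) : chain_map _ _) n)
      (minus_r f_homo y))
    (at_ob ((fmap PM w : chain_map _ _) (n + 1)) (minus_r f_homo y)).
Proof. by []. Qed.

Definition plus_minus_shift : nat_trans
  (functor_comp PM (shift_functor DP)) (functor_comp (shift_functor DM) PM).
Proof.
exists plus_minus_shift_map => K L w.
apply: chain_ev_inj => -[x|y] n.
  exact (plus_minus_shift_natural_l w n x).
exact (idm_square (plus_minus_shift_natural_r w n y)).
Defined.

Lemma plus_minus_shift_iso K : is_iso (plus_minus_shift K).
Proof.
apply: chain_ev_iso => -[x|y] n; last exact: is_iso_id.
exact: bisign_iso.
Qed.

(* Both sides are typed by explicit biproducts: letting Rocq compare the objects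
   of PM (cone w) with those of cone (fmap PM w) makes it unfold the two posets,
   which takes too long. *)
Section ConeAtRight.
Variables (K L : complex_cat DP) (w : hom K L) (y : Y) (n : int).
Let T : Type :=
  hom (biprod ((K (n + 1) : functor Plus A) (plus_r f_homo y))
              ((L n : functor Plus A) (plus_r f_homo y)))
      (biprod ((K (n + 1 + 1) : functor Plus A) (plus_r f_homo y))
              ((L (n + 1) : functor Plus A) (plus_r f_homo y))).

Lemma plus_minus_cone_dif_r :
  @eq T (at_ob (dif (PM (cone w)) n) (minus_r f_homo y))
        (at_ob (dif (cone (fmap PM w)) n) (minus_r f_homo y)).
Proof.
pose M : T := pair_m (- (at_ob (dif K (n + 1)) (plus_r f_homo y) \c prl_m _ _))
    (at_ob ((w : chain_map K L) (n + 1)) (plus_r f_homo y) \c prl_m _ _ +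
     at_ob (dif L n) (plus_r f_homo y) \c prr_m _ _).
have e1 : @eq T (at_ob (dif (cone w) n) (plus_r f_homo y))
  (at_ob (dif (PM (cone w)) n) (minus_r f_homo y)) := dif_plus_minus_r (cone w) y n.
have e2 : @eq T (at_ob (dif (cone w) n) (plus_r f_homo y)) M :=
  dif_cone_at w (plus_r f_homo y) n.
have e3 : @eq T (at_ob (dif (cone (fmap PM w)) n) (minus_r f_homo y)) M :=
  dif_cone_at (fmap PM w) (minus_r f_homo y) n.
exact: (etrans (etrans (esym e1) e2) (esym e3)).
Qed.

End ConeAtRight.

(** Iterated cones occur only over [X], where [biswap] exchanges them; over [Y] both sides are the
    cone of [w] at [y]. *)
Definition plus_minus_cone_at (K L : complex_cat DP) (w : hom K L) (p : Minus) :
  chain_map (complex_ev (PM (cone w)) p) (complex_ev (cone (fmap PM w)) p).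
Proof.
case: p => [x|y].
  exists (fun n => biswap
    ((K (n + 1 + 1) : functor Plus A) (plus_l f_homo x))
    ((L (n + 1) : functor Plus A) (plus_l f_homo x))
    ((K (n + 1) : functor Plus A) (plus_r f_homo (f x)))
    ((L n : functor Plus A) (plus_r f_homo (f x)))) => n.
  exact: plus_minus_cone_dif.
exists (fun n => idm (biprod ((K (n + 1) : functor Plus A) (plus_r f_homo y))
                        ((L n : functor Plus A) (plus_r f_homo y)))) => n.
exact: (idm_square (plus_minus_cone_dif_r w y n)).
Defined.

Section ConeNatural.
Variables (K L : complex_cat DP) (w : hom K L) (n : int).
Let KL m (x : X) := (K m : functor Plus A) (plus_l f_homo x).
Let KR m (y : Y) := (K m : functor Plus A) (plus_r f_homo y).
Let LL m (x : X) := (L m : functor Plus A) (plus_l f_homo x).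
Let LR m (y : Y) := (L m : functor Plus A) (plus_r f_homo y).

Lemma plus_minus_cone_ll (x x' : X) (h : (x <= x')%O) :
  biswap (KL (n + 1 + 1) x') (LL (n + 1) x') (KR (n + 1) (f x')) (LR n (f x')) \c
    fmap (PM (cone w) n : functor Minus A) (minus_ll f_homo h) =
  fmap (cone (fmap PM w) n : functor Minus A) (minus_ll f_homo h) \c
    biswap (KL (n + 1 + 1) x) (LL (n + 1) x) (KR (n + 1) (f x)) (LR n (f x)).
Proof.
rewrite (fmap_plus_minus_ll (cone w)) !(fmap_cone_at w) (fmap_cone_at (fmap PM w)).
rewrite (fmap_plus_minus_ll K) (fmap_plus_minus_ll L).
exact: biswap_diag.
Qed.

Lemma plus_minus_cone_rl (x : X) (y : Y) (h : (y <= f x)%O) :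
  biswap (KL (n + 1 + 1) x) (LL (n + 1) x) (KR (n + 1) (f x)) (LR n (f x)) \c
    fmap (PM (cone w) n : functor Minus A) (minus_rl f_homo h) =
  fmap (cone (fmap PM w) n : functor Minus A) (minus_rl f_homo h) \c
    idm (biprod (KR (n + 1) y) (LR n y)).
Proof.
rewrite (fmap_plus_minus_rl (cone w)) (fmap_cone_at w) (fmap_cone_at (fmap PM w)).
rewrite (fmap_plus_minus_rl K) (fmap_plus_minus_rl L).
exact: biswap_inr_diag.
Qed.

Lemma plus_minus_cone_rr (y y' : Y) (h : (y <= y')%O) :
  @eq (hom (biprod (KR (n + 1) y) (LR n y)) (biprod (KR (n + 1) y') (LR n y')))
    (fmap (PM (cone w) n : functor Minus A) (minus_rr f_homo h))
    (fmap (cone (fmap PM w) n : functor Minus A) (minus_rr f_homo h)).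
Proof.
pose T := hom (biprod (KR (n + 1) y) (LR n y)) (biprod (KR (n + 1) y') (LR n y')).
pose M : T := pair_m (fmap (K (n + 1) : functor Plus A) (plus_rr f_homo h) \c prl_m _ _)
    (fmap (L n : functor Plus A) (plus_rr f_homo h) \c prr_m _ _).
have e1 : @eq T (fmap (cone w n : functor Plus A) (plus_rr f_homo h))
  (fmap (PM (cone w) n : functor Minus A) (minus_rr f_homo h)) :=
  fmap_plus_minus_rr (cone w) h n.
have e2 : @eq T (fmap (cone w n : functor Plus A) (plus_rr f_homo h)) M :=
  fmap_cone_at w (plus_rr f_homo h) n.
have e3 : @eq T (fmap (cone (fmap PM w) n : functor Minus A) (minus_rr f_homo h)) M :=
  fmap_cone_at (fmap PM w) (minus_rr f_homo h) n.
exact: (etrans (etrans (esym e1) e2) (esym e3)).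
Qed.

End ConeNatural.

Definition plus_minus_cone (K L : complex_cat DP) (w : hom K L) :
  chain_map (PM (cone w)) (cone (fmap PM w)).
Proof.
apply: (chain_of_family (a := plus_minus_cone_at w)).
case=> [x|y] [x'|y'] // h n.
- exact (plus_minus_cone_ll w n h).
- exact (plus_minus_cone_rl w n h).
- exact (idm_square (plus_minus_cone_rr w n h)).
Defined.

Lemma plus_minus_cone_iso (K L : complex_cat DP) (w : hom K L) :
  is_iso (plus_minus_cone w : @hom (complex_cat DM) _ _).
Proof.
apply: chain_ev_iso => -[x|y] n; last exact: is_iso_id.
exact: biswap_iso.
Qed.

Section ConeTriangle.
Variables (K L : complex_cat DP) (w : hom K L) (n : int).
Let KL m (x : X) := (K m : functor Plus A) (plus_l f_homo x).
Let KR m (y : Y) := (K m : functor Plus A) (plus_r f_homo y).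
Let LL m (x : X) := (L m : functor Plus A) (plus_l f_homo x).
Let LR m (y : Y) := (L m : functor Plus A) (plus_r f_homo y).

Lemma plus_minus_cone_inr_l (x : X) :
  biswap (KL (n + 1 + 1) x) (LL (n + 1) x) (KR (n + 1) (f x)) (LR n (f x)) \c
    at_ob ((fmap PM (cone_inr w : @hom (complex_cat DP) L (cone w)) : chain_map _ _) n)
      (minus_l f_homo x) =
  inr_m (biprod (KL (n + 1 + 1) x) (KR (n + 1) (f x)))
    (biprod (LL (n + 1) x) (LR n (f x))).
Proof. exact: biswap_inr. Qed.

Lemma plus_minus_cone_inr_r (y : Y) :
  @eq (hom (LR n y) (biprod (KR (n + 1) y) (LR n y)))
   (at_ob ((fmap PM (cone_inr w : @hom (complex_cat DP) L (cone w)) : chain_map _ _) n)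
      (minus_r f_homo y))
   (inr_m (KR (n + 1) y) (LR n y)).
Proof. by []. Qed.

Lemma plus_minus_cone_prl_l (x : X) :
  prl_m (biprod (KL (n + 1 + 1) x) (KR (n + 1) (f x)))
    (biprod (LL (n + 1) x) (LR n (f x))) \c
  biswap (KL (n + 1 + 1) x) (LL (n + 1) x) (KR (n + 1) (f x)) (LR n (f x)) =
  bisign (KL (n + 1 + 1) x) (KR (n + 1) (f x)) \c
    at_ob ((fmap PM (cone_prl w : @hom (complex_cat DP) (cone w) (shift_complex K))
      : chain_map _ _) n) (minus_l f_homo x).
Proof. exact: biswap_prl. Qed.

End ConeTriangle.

Lemma plus_minus_cone_inr (K L : complex_cat DP) (w : hom K L) :
  (plus_minus_cone w : @hom (complex_cat DM) _ _) \c
    fmap PM (cone_inr w : @hom (complex_cat DP) L (cone w)) =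
  (cone_inr (fmap PM w) : @hom (complex_cat DM) _ _).
Proof.
apply: chain_ev_inj => -[x|y] n.
  exact (plus_minus_cone_inr_l w n x).
exact (etrans (comp1m _) (plus_minus_cone_inr_r w n y)).
Qed.

Lemma plus_minus_cone_prl (K L : complex_cat DP) (w : hom K L) :
  (cone_prl (fmap PM w) : @hom (complex_cat DM) _ (shift_functor DM (PM K))) \c
    (plus_minus_cone w : @hom (complex_cat DM) _ _) =
  plus_minus_shift K \c
    fmap PM (cone_prl w : @hom (complex_cat DP) (cone w) (shift_functor DP K)).
Proof.
apply: chain_ev_inj => -[x|y] n.
  exact (plus_minus_cone_prl_l w n x).
exact (etrans (compm1 (prl_m ((K (n + 1) : functor Plus A) (plus_r f_homo y))
  ((L n : functor Plus A) (plus_r f_homo y)))) (esym (comp1m _))).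
Qed.

End ConeCompatibility.

Theorem corollary1p3 (d d' : Order.disp_t)
    (X : finPOrderType d) (Y : finPOrderType d')
    (f : X -> Y) (f_homo : {homo f : x x' / (x <= x')%O}) :
  universally_derived_equivalent (glue_plus f_homo) (glue_minus f_homo).
Proof.
move=> A.
exact (derived_triangle_equivalence (@plus_minus_quasi_iso _ _ _ _ _ f_homo A)
  (@minus_plus_quasi_iso _ _ _ _ _ f_homo A)
  (@kappa_quasi_iso _ _ _ _ _ f_homo A) (@theta_quasi_iso _ _ _ _ _ f_homo A)
  (@plus_minus_shift_iso _ _ _ _ _ f_homo A) (@plus_minus_cone_iso _ _ _ _ _ f_homo A)
  (@plus_minus_cone_inr _ _ _ _ _ f_homo A) (@plus_minus_cone_prl _ _ _ _ _ f_homo A)).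
Qed.
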